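(* Let $A$, $(\varepsilon_n)$, $(\xi_n)$, $(e_n)$, $(\gamma_n)$ and $(\Delta_n)$ be as in the context and satisfy conditions (i)–(v). Then $\bar\Delta_n=\frac1n\sum_{i=1}^n\Delta_i$ satisfies $$\sqrt n\,\bar\Delta_n\xrightarrow{D}\mathcal N(0,A^{-1}\Sigma A^{-1}).$$
   Context: Let $(\mathcal F_n)_{n\ge0}$ be an increasing sequence of $\sigma$-fields, $A$ a $d\times d$ matrix, $(\gamma_n)$ positive step sizes, $(\varepsilon_n),(\xi_n),(e_n)$ random vectors in $\mathbb R^d$ adapted to $(\mathcal F_n)$, $\Delta_0\in\mathbb R^d$, and $\Delta_n=\Delta_{n-1}-\gamma_nA\Delta_{n-1}+\gamma_n(\varepsilon_n+\xi_n+e_n)$. Conditions: (i) $A$ is symmetric positive definite. (ii) $(\varepsilon_n)$ is a martingale-difference sequence ($\mathbb E[\varepsilon_n\mid\mathcal F_{n-1}]=0$, $\sup_n\mathbb E\|\varepsilon_n\|^2<\infty$), there is $C>0$ with $\mathbb E[\|\varepsilon_n\|^4\mid\mathcal F_{n-1}]\le C$ for all $n$, and there is a matrix $\Sigma\succ0$ with $\mathbb E[\varepsilon_n\varepsilon_n^\top\mid\mathcal F_{n-1}]\to\Sigma$ in probability. (iii) $(\xi_n)$ is a martingale-difference sequence ($\mathbb E[\xi_n\mid\mathcal F_{n-1}]=0$, $\sup_n\mathbb E\|\xi_n\|^2<\infty$) and there are $N$ and $K>0$ such that $\mathbb E[\|\xi_n\|^2\mid\mathcal F_{n-1}]\le K\gamma_n$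 a.s. for all $n\ge N$. (iv) $\mathbb E[\|e_n\|]=O(\gamma_n)$. (v) $\gamma_n\to0$, $\frac{\gamma_n-\gamma_{n-1}}{\gamma_n}=o(\gamma_n)$, and $\sum_{j\ge1}\gamma_j/\sqrt j<\infty$. *)

(* Defs.v *)
From HB Require Import structures.
From mathcomp Require Import all_boot all_order all_algebra.
From mathcomp Require Import all_classical all_reals all_analysis.
Set Implicit Arguments. Unset Strict Implicit. Unset Printing Implicit Defensive.
Import Order.TTheory GRing.Theory Num.Theory.
Import numFieldNormedType.Exports.
Local Open Scope classical_set_scope.
Local Open Scope ring_scope.

Section Defs.
Context {R : realType}.

Definition enorm {n : nat} (v : 'cV[R]_n) : R :=
  Num.sqrt (\sum_(i < n) (v i ord0) ^+ 2).
Definition fnorm {m n : nat} (M : 'M[R]_(m, n)) : R :=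
  Num.sqrt (\sum_(i < m) \sum_(j < n) (M i j) ^+ 2).

Definition sym_posdef {n : nat} (M : 'M[R]_n) : Prop :=
  M^T = M /\ forall v : 'cV[R]_n, v != 0 -> 0 < (v^T *m M *m v) ord0 ord0.

Context {d : measure_display} {T : measurableType d}.

Definition Gmeasurable (G : set (set T)) (f : T -> R) : Prop :=
  forall B : set R, measurable B -> G (f @^-1` B).

Definition Gmeasurable_vec {n : nat} (G : set (set T)) (X : T -> 'cV[R]_n) :=
  forall i : 'I_n, Gmeasurable G (fun t => X t i ord0).

Definition filtration (F : nat -> set (set T)) : Prop :=
  (forall n, sigma_algebra setT (F n)) /\
  (forall n, F n `<=` measurable) /\
  (forall n m, (n <= m)%N -> F n `<=` F m).

Definition is_cond_exp (P : probability T R) (G : set (set T)) (X Y : T -> R) : Prop :=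
  P.-integrable setT (EFin \o X) /\
  Gmeasurable G Y /\ P.-integrable setT (EFin \o Y) /\
  forall B, G B -> (\int[P]_(t in B) (X t)%:E = \int[P]_(t in B) (Y t)%:E)%E.

Definition mds {n0 : nat} (P : probability T R) (F : nat -> set (set T))
    (X : nat -> T -> 'cV[R]_n0) : Prop :=
  (forall n, (0 < n)%N -> forall i : 'I_n0,
      is_cond_exp P (F n.-1) (fun t => X n t i ord0) (fun _ => 0)) /\
  (exists M : R, forall n, (0 < n)%N ->
      (\int[P]_t ((enorm (X n t)) ^+ 2)%:E <= M%:E)%E).

Definition cond_exp_le (P : probability T R) (G : set (set T)) (Z : T -> R) (c : R) :=
  exists Y : T -> R, is_cond_exp P G Z Y /\ {ae P, forall t, Y t <= c}.

Definition cvg_in_prob {m n : nat} (P : probability T R)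
    (V : nat -> T -> 'M[R]_(m, n)) (S : 'M[R]_(m, n)) : Prop :=
  forall eps : R, 0 < eps ->
    P [set t | eps < fnorm (V k t - S)] @[k --> \oo] --> 0%E.

End Defs.

(* Y is a centred Gaussian random vector with covariance M, i.e. its
   characteristic function is u |-> exp(- u^T M u / 2) *)
Definition gaussian_vec {R : realType} {d : measure_display} {T : measurableType d}
    {n : nat} (P : probability T R) (Y : T -> 'cV[R]_n) (M : 'M[R]_n) : Prop :=
  (forall i : 'I_n, measurable_fun setT (fun t => Y t i ord0)) /\
  forall u : 'cV[R]_n,
    (\int[P]_t (cos ((u^T *m Y t) ord0 ord0))%:E =
       (expR (- (u^T *m M *m u) ord0 ord0 / 2))%:E)%E /\
    (\int[P]_t (sin ((u^T *m Y t) ord0 ord0))%:E = 0)%E.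

Definition cvg_dist_normal {R : realType} {d : measure_display} {T : measurableType d}
    {n : nat} (P : probability T R) (X : nat -> T -> 'cV[R]_n) (M : 'M[R]_n) : Prop :=
  forall (d' : measure_display) (T' : measurableType d') (P' : probability T' R)
         (Y : T' -> 'cV[R]_n),
    gaussian_vec P' Y M ->
    forall f : 'cV[R]_n -> R, continuous f -> (exists B : R, forall x, `|f x| <= B) ->
      (\int[P]_t (f (X k t))%:E)%E @[k --> \oo] --> (\int[P']_t (f (Y t))%:E)%E.

(* Main.v *)
(* Each iterate is linear in the noise, so for a vector u the sum of the
   <u, Delta_i> is a fixed initial term plus the sum over k of <w_{n,k}, noise_k>,
   where the weights solve a backward recursion in k.  The difference
   d_{n,k} = w_{n,k} - A^-1 u satisfies
     d_{n,k} = (rho_k - 1) A^-1 u + rho_k (1 - gamma_{k+1} A) d_{n,k+1},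
     rho_k = gamma_k / gamma_{k+1} = 1 + o(gamma_{k+1}),
   and 1 - gamma A contracts by a factor 1 - m gamma, so d is bounded and its
   Cesaro mean over k <= n vanishes.  Orthogonality of martingale differences
   in L^2, Kronecker's lemma for the bias e and a second moment bound for xi
   then reduce <u, sqrt n mean> to n^-1/2 sum_k <A^-1 u, eps_k> up to a term that
   vanishes in probability.  A one-step Taylor expansion of cos gives the
   characteristic function of that martingale sum.  Finally tightness (from L^2
   bounds) and the density of trigonometric polynomials among bounded continuous
   functions on boxes upgrade convergence of characteristic functions to
   convergence in distribution. *)
Require Import Defs.
From HB Require Import structures.
From mathcomp Require Import all_boot all_order all_algebra finmap.
From mathcomp Require Import all_classical all_reals all_analysis.
From mathcomp Require Import measurable_realfun ring lra zify.
Import Order.TTheory GRing.Theory Num.Theory.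
Import numFieldNormedType.Exports.
Local Open Scope classical_set_scope.
Local Open Scope ring_scope.
Set Implicit Arguments. Unset Strict Implicit. Unset Printing Implicit Defensive.

(** * Real sequences *)

(** Conditional variances converge only in probability, which gives no control along single paths.
    The recursion for characteristic functions needs less: that [E[Z (<v, eps_k>^2 - s2)]] tends to
    0 uniformly over [F k.-1]-measurable [Z] bounded by 1. Fourth moments provide this. As [s2] is
    deterministic, each step multiplies the characteristic function by [exp(-s2 / (2n))] outside the
    expectation, and the errors of the [n] steps add up to o(1). The bias is known to be integrable
    only from some index on, so the remainder is measured by [E min(1, |.|)] and not in mean. For
    the weights, dividing the contraction inequality by [gamma] and summing by parts bounds the sum
    of [|d|] by multiples of [1 / gamma_n] and of the sum of the relative increments [e_j] of
    [gamma]; both are o(n), since increments of [1 / gamma] are at most [2 e_j]. In the density step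
    a trigonometric polynomial plays the role of a distance in an inf-convolution, so that
    everything rests on approximating [|t|] by polynomials. *)

Section sequences.
Context {R : realType}.
Implicit Types (u v g a e : nat -> R) (n j k J : nat).

Lemma cvg0_le u v J : (forall n, (J <= n)%N -> `|u n| <= v n) ->
  v @ \oo --> 0 -> u @ \oo --> 0.
Proof.
move=> uv v0; apply/norm_cvg0P.
apply: (@squeeze_cvgr _ _ _ _ (fun=> 0) v) => //; last exact: cvg_cst.
by exists J => // n /= Jn; rewrite normr_ge0 uv.
Qed.

Lemma cvg0D u v : u @ \oo --> 0 -> v @ \oo --> 0 ->
  (fun n => u n + v n) @ \oo --> 0.
Proof. by move=> u0 v0; rewrite -(addr0 (0 : R)); exact: cvgD. Qed.

Lemma cvg0Ml u (c : R) : u @ \oo --> 0 -> (fun n => c * u n) @ \oo --> 0.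
Proof. by move=> u0; rewrite -(mulr0 c); exact: cvgMl_tmp. Qed.

Lemma cvg0Mr u (c : R) : u @ \oo --> 0 -> (fun n => u n * c) @ \oo --> 0.
Proof. by move=> u0; rewrite -(mul0r c); exact: cvgMr_tmp. Qed.

Lemma cvg_invn0 : (fun n => n%:R^-1 : R) @ \oo --> 0.
Proof.
rewrite -cvg_shiftS; exact: cvg_harmonic.
Qed.

Lemma cesaro0 u : u @ \oo --> 0 ->
  (fun n => n%:R^-1 * \sum_(0 <= j < n) u j) @ \oo --> 0.
Proof.
move=> u0; rewrite -cvg_shiftS.
exact: (cesaro u0).
Qed.

Lemma eventually_le u (c : R) : u @ \oo --> 0 -> 0 < c ->
  exists J, forall n, (J <= n)%N -> `|u n| <= c.
Proof.
move=> /cvgr0Pnorm_le u0 c0; have [J _ H] := u0 _ c0.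
by exists J => n Jn; exact: H.
Qed.

Lemma cvg_inv_sqrtn0 : (fun n => (Num.sqrt n%:R)^-1 : R) @ \oo --> 0.
Proof.
rewrite -(sqrtr0 R) (_ : (fun n => _) = (fun n => Num.sqrt (n%:R^-1))).
  by apply: (cvg_comp _ _ cvg_invn0); exact: sqrt_continuous.
by apply/funext => n; rewrite sqrtrV.
Qed.

(** Past a cutoff [m], [1 / sqrt n] is at most [1 / sqrt j.+1], so the scaled sum is dominated by a
    tail of the convergent series; the finitely many terms before [m] are killed by [1 / sqrt n]. *)
Lemma kronecker_sqrt g : (forall n, (0 < n)%N -> 0 < g n) ->
  cvg (series (fun j => g j.+1 / Num.sqrt j.+1%:R) @ \oo) ->
  (fun n => (Num.sqrt n%:R)^-1 * \sum_(1 <= j < n.+1) g j) @ \oo --> 0.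
Proof.
set t := (fun j => _) => g0 cs.
have t0 j : 0 <= t j by rewrite divr_ge0 ?sqrtr_ge0// ltW// g0.
have tle n : series t n <= limn (series t).
  by apply: nondecreasing_cvgn_le => //; exact: nondecreasing_series.
apply/cvgr0Pnorm_le => _/posnumP[e].
have e2 : 0 < e%:num / 2 by [].
have [m _ Hm] := (cvgrPdist_le _ _).1 cs _ e2.
have [m' Hm'] : exists m', forall n, (m' <= n)%N ->
    `|(Num.sqrt n%:R)^-1 * \sum_(0 <= j < m) g j.+1| <= e%:num / 2.
  by apply: eventually_le e2; apply: cvg0Mr; exact: cvg_inv_sqrtn0.
exists (maxn m m') => // n /=; rewrite geq_max => /andP[mn m'n].
rewrite big_add1/= (big_cat_nat (leq0n m) mn)//= mulrDr.
apply: le_trans (ler_normD _ _) _; rewrite [leRHS]splitr; apply: lerD.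
  exact: Hm'.
rewrite ger0_norm; last first.
  rewrite mulr_ge0 ?invr_ge0 ?sqrtr_ge0// big_nat sumr_ge0// => j _.
  by rewrite ltW// g0.
apply: le_trans (_ : series t n - series t m <= _).
  rewrite sub_series mn mulr_sumr big_nat [leRHS]big_nat.
  apply: ler_sum => j /andP[_ jn]; rewrite mulrC /t.
  rewrite ler_pM2l ?g0// lef_pV2 ?posrE ?sqrtr_gt0 ?ltr0n//; last by lia.
  by rewrite ler_sqrt// ler_nat.
have := Hm m (leqnn m); rewrite /= ger0_norm ?subr_ge0//.
have := tle n; lra.
Qed.

(** * Backward recursions contracting at rate [m * g j.+1] *)

Section backward.
Variables (g e kap : nat -> R) (a : nat -> nat -> R) (c m C0 : R) (J : nat).
Hypotheses (m0 : 0 < m) (c0 : 0 <= c) (J0 : (0 < J)%N).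
Hypothesis g0 : forall j, (0 < j)%N -> 0 < g j.
Hypothesis mg1 : forall j, (J <= j)%N -> m * g j.+1 <= 1.
Hypothesis e1 : forall j, (J <= j)%N -> 0 <= e j <= 1.
Hypothesis a0 : forall n j, 0 <= a n j.
Hypothesis an : forall n, (0 < n)%N -> a n n <= C0.
Hypothesis astep : forall n j, (J <= j < n)%N ->
  a n j <= e j * g j.+1 * c + (1 - m * g j.+1) * a n j.+1.
Hypothesis kap0 : forall j, 0 <= kap j.
Hypothesis akap : forall n j, (0 < j < n)%N -> a n j <= kap j * (1 + a n j.+1).

(** Past [J] there is a barrier: if [a n j.+1 <= B] with [c <= m * B], the forcing [g j.+1 * c] is
    absorbed by the contraction. Below [J] finitely many steps remain, and each costs one
    application of [akap], with constants free of [n]. *)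
Lemma backward_bounded :
  exists2 B : R, 0 <= B & forall n j, (0 < j <= n)%N -> a n j <= B.
Proof.
have C00 : 0 <= C0 by exact: le_trans (a0 1 1) (an _).
(* [k] is the number of indices below [J] already reached; at [k = J] no restriction on [j] is
   left. *)
suff /(_ J)[B HB] : forall k, exists B, forall n j, (J <= j + k)%N ->
    (0 < j <= n)%N -> a n j <= B.
  exists B; last by move=> n j jn; apply: HB => //; rewrite leq_addl.
  by apply: le_trans (HB 1%N 1%N _ _) => //; rewrite leq_addl.
elim=> [|k [B HB]].
  pose B := Num.max C0 (c / m); exists B => n j; rewrite addn0 => Jj /andP[j0 jn].
  have cB : c <= m * B.
    by rewrite mulrC -ler_pdivrMr// /B le_max lexx orbT.
  have [i] : exists i, (n - j = i)%N by exists (n - j)%N.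
  elim: i j Jj j0 jn => [|i IH] j Jj j0 jn nj.
    have -> : j = n by lia.
    by rewrite /B le_max an//; lia.
  have jn' : (j < n)%N by lia.
  have := IH j.+1 (leqW Jj) isT jn' ltac:(lia).
  move=> aB; apply: le_trans (astep (n := n) (j := j) _) _; first by lia.
  have gj := g0 (j := j.+1) isT.
  have := mg1 Jj; have /andP[e0' e1'] := e1 Jj => mg.
  have : (1 - m * g j.+1) * a n j.+1 <= (1 - m * g j.+1) * B.
    by apply: ler_wpM2l aB; rewrite subr_ge0.
  have : e j * g j.+1 * c <= 1 * g j.+1 * (m * B).
    by apply: ler_pM => //; [rewrite mulr_ge0// ltW|rewrite ler_pM2r].
  lra.
pose B' := Num.max (Num.max B C0) (kap (J - k.+1)%N * (1 + Num.max B 0)).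
exists B' => n j Jj /andP[j0 jn].
have [Jjk|Jjk] := leqP J (j + k)%N.
  by rewrite /B' !le_max HB//; lia.
have jE : j = (J - k.+1)%N by lia.
move: jn; rewrite leq_eqVlt => /predU1P[<-|jn].
  by rewrite /B' !le_max an// orbT.
rewrite {}/B' le_max; apply/orP; right.
apply: le_trans (akap (n := n) (j := j) _) _; first by lia.
rewrite jE; apply: ler_wpM2l => //; rewrite lerD2l le_max HB//; lia.
Qed.

Hypothesis ge : forall j, (J <= j)%N -> `|(g j)^-1 - (g j.+1)^-1| <= 2 * e j.
Hypothesis ecvg : e @ \oo --> 0.
Hypothesis ep : forall j, 0 <= e j.

(** Divided by [g j.+1], the contraction term becomes [m * a n j.+1], and the difference of
    consecutive [a] is summed by parts against [1 / g], whose increments [ge] controls. The boundary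
    term [a n n / g n] is at most [B * (1 / g J + 2 * S n)], so it is o(n) as well, the means of [e]
    tending to 0. *)
Lemma backward_mean_cvg0 :
  (fun n => n%:R^-1 * \sum_(1 <= j < n.+1) a n j) @ \oo --> 0.
Proof.
have [B B0 HB] := backward_bounded.
pose S n := \sum_(0 <= j < n) e j.
have Smono n : S n <= S n.+1 by rewrite /S big_nat_recr//= lerDl.
have bJ k : (J <= k)%N -> (g k)^-1 <= (g J)^-1 + 2 * S k.
  elim: k => [|k IH]; first by lia.
  rewrite leq_eqVlt => /predU1P[<-|Jk].
    by rewrite lerDl mulr_ge0// sumr_ge0.
  have := IH Jk; have := ge (j := k) Jk; rewrite /S big_nat_recr//= -/(S k).
  rewrite ler_norml => /andP[h1 h2]; lra.
have key n k : (J <= k <= n)%N -> m * \sum_(J <= j < k) a n j.+1 <=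
    a n k * (g k)^-1 - a n J * (g J)^-1 + (2 * B + c) * S k.
  elim: k => [|k IH]; first by lia.
  case/andP; rewrite leq_eqVlt => /predU1P[<- _|Jk kn].
    rewrite big_geq// mulr0 subrr add0r mulr_ge0//; last exact: sumr_ge0.
    by rewrite addr_ge0// mulr_ge0.
  have {}IH := IH ltac:(lia).
  rewrite big_nat_recr//= /S big_nat_recr//= -/(S k).
  have gk := g0 (j := k.+1) isT.
  have st : m * a n k.+1 <= (a n k.+1 - a n k) * (g k.+1)^-1 + c * e k.
    rewrite -(ler_pM2r gk) [leRHS]mulrDl mulfVK ?gt_eqF//.
    have := astep (n := n) (j := k) ltac:(lia); lra.
  have st2 : a n k * ((g k)^-1 - (g k.+1)^-1) <= B * (2 * e k).
    have := ge (j := k) Jk; rewrite ler_norml => /andP[h1 h2].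
    have /ler_wpM2l : 0 <= a n k by [].
    move=> /(_ _ _ h2) h; apply: le_trans h _.
    by apply: ler_wpM2r; [rewrite mulr_ge0|apply: HB; lia].
  lra.
(* [4 * B + c] collects [2 * B + c] from the summation by parts and [2 * B] from the boundary term;
   [D] holds what does not depend on [n], including the indices up to [J]. *)
pose D := (J%:R * B + (B * (g J)^-1) / m) : R.
pose D' := ((4 * B + c) / m) : R.
apply: (@cvg0_le _ (fun n => n%:R^-1 * D + D' * (n%:R^-1 * S n)) J); last first.
  apply: cvg0D; first by apply: cvg0Mr; exact: cvg_invn0.
  by apply: cvg0Ml; exact: cesaro0.
move=> n Jn; rewrite ger0_norm; last by rewrite mulr_ge0 ?invr_ge0// sumr_ge0.
rewrite mulrCA -mulrDr; apply: ler_wpM2l; first by rewrite invr_ge0.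
rewrite big_add1/= (big_cat_nat (leq0n J) Jn)//=.
have gJ : 0 < (g J)^-1 by rewrite invr_gt0 g0.
have h1 : \sum_(0 <= j < J) a n j.+1 <= J%:R * B.
  rewrite big_nat; apply: le_trans (_ : \sum_(0 <= j < J | (0 <= j < J)%N) B <= _).
    by apply: ler_sum => j jJ; apply: HB; lia.
  by rewrite -big_nat sumr_const_nat subn0 mulr_natl.
have h2 := key n n ltac:(lia).
have h3 : a n n * (g n)^-1 <= B * ((g J)^-1 + 2 * S n).
  by apply: ler_pM => //; [rewrite invr_ge0 ltW// g0//; lia|apply: HB; lia|apply: bJ].
have h4 : 0 <= a n J * (g J)^-1 by rewrite mulr_ge0// ltW.
have h5 : \sum_(J <= j < n) a n j.+1 <= B * (g J)^-1 / m + D' * S n.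
  by rewrite -(ler_pM2l m0) mulrDr mulrCA mulfV ?gt_eqF// /D' mulrA mulrCA mulfV ?gt_eqF//; lra.
by rewrite /D; lra.
Qed.

End backward.
End sequences.

(** * Euclidean geometry of symmetric positive definite matrices *)

Section euclid.
Context {R : realType} {p : nat}.
Implicit Types (x y z : 'cV[R]_p) (A : 'M[R]_p).

Definition dot x y : R := (x^T *m y) ord0 ord0.

Lemma dotE x y : dot x y = \sum_i x i ord0 * y i ord0.
Proof. by rewrite /dot mxE; apply: eq_bigr => i _; rewrite mxE. Qed.

Lemma dotC x y : dot x y = dot y x.
Proof. by rewrite !dotE; apply: eq_bigr => i _; rewrite mulrC. Qed.

Lemma dotDr x y z : dot x (y + z) = dot x y + dot x z.
Proof. by rewrite /dot mulmxDr mxE. Qed.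

Lemma dotDl x y z : dot (y + z) x = dot y x + dot z x.
Proof. by rewrite dotC dotDr !(dotC x). Qed.

Lemma dotZr x y (c : R) : dot x (c *: y) = c * dot x y.
Proof. by rewrite /dot -scalemxAr mxE. Qed.

Lemma dotZl x y (c : R) : dot (c *: x) y = c * dot x y.
Proof. by rewrite dotC dotZr dotC. Qed.

Lemma dotNr x y : dot x (- y) = - dot x y.
Proof. by rewrite -scaleN1r dotZr mulN1r. Qed.

Lemma dotNl x y : dot (- x) y = - dot x y.
Proof. by rewrite dotC dotNr dotC. Qed.

Lemma dot0r x : dot x 0 = 0.
Proof. by rewrite /dot mulmx0 mxE. Qed.

Lemma dot0l x : dot 0 x = 0.
Proof. by rewrite dotC dot0r. Qed.

Lemma dot_sumr (I : Type) (r : seq I) (Q : pred I) x (F : I -> 'cV[R]_p) :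
  dot x (\sum_(i <- r | Q i) F i) = \sum_(i <- r | Q i) dot x (F i).
Proof. by rewrite /dot mulmx_sumr summxE. Qed.

Lemma dot_mulmxr A x y : dot x (A *m y) = dot (A^T *m x) y.
Proof. by rewrite /dot trmx_mul trmxK mulmxA. Qed.

Lemma dot_delta i x : dot (delta_mx i ord0) x = x i ord0.
Proof.
rewrite dotE (bigD1 i)//= mxE !eqxx mul1r big1 ?addr0// => k ki.
by rewrite mxE (negbTE ki) mul0r.
Qed.

Lemma dot_ge0 x : 0 <= dot x x.
Proof. by rewrite dotE sumr_ge0// => i _; rewrite -expr2 sqr_ge0. Qed.

Lemma dot_gt0 x : x != 0 -> 0 < dot x x.
Proof.
move=> x0; rewrite lt0r dot_ge0 andbT; apply: contra x0.
rewrite dotE psumr_eq0 => [/allP h|i _]; last by rewrite -expr2 sqr_ge0.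
apply/eqP/matrixP => i j; rewrite ord1 mxE.
by have := h i (mem_index_enum _); rewrite /= mulf_eq0 orbb => /eqP.
Qed.

Lemma enorm_ge0 x : 0 <= enorm x.
Proof. exact: sqrtr_ge0. Qed.

Lemma sqr_enorm x : enorm x ^+ 2 = dot x x.
Proof.
rewrite /enorm sqr_sqrtr; last by apply: sumr_ge0 => i _; exact: sqr_ge0.
by rewrite dotE; apply: eq_bigr => i _; rewrite expr2.
Qed.

Lemma sym_posdef_dot A : sym_posdef A ->
  A^T = A /\ forall v, v != 0 -> 0 < dot v (A *m v).
Proof. by case=> sA pA; split=> // v v0; rewrite /dot mulmxA pA. Qed.

(* The form evaluated at <y, A y> x - <x, A y> y is <y, A y> times the gap. *)
Lemma cauchy_schwarz_form A x y : sym_posdef A ->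
  dot x (A *m y) ^+ 2 <= dot x (A *m x) * dot y (A *m y).
Proof.
case/sym_posdef_dot => sA pA.
have pA0 v : 0 <= dot v (A *m v).
  by have [->|/pA/ltW//] := eqVneq v 0; rewrite dot0l.
have [->|y0] := eqVneq y 0; first by rewrite mulmx0 !dot0r expr0n mulr0.
have := pA0 (dot y (A *m y) *: x - dot x (A *m y) *: y).
have yx : dot y (A *m x) = dot x (A *m y) by rewrite dot_mulmxr sA dotC.
rewrite mulmxBr -!scalemxAr !(dotDl, dotDr, dotNl, dotNr, dotZl, dotZr) yx.
have := pA _ y0; move: (dot y (A *m y)) (dot x (A *m y)) (dot x (A *m x)).
move=> c b a c0 h; rewrite -subr_ge0 -(pmulr_rge0 _ c0).
by move: h; congr (0 <= _); ring.
Qed.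

Lemma sym_posdef1 : sym_posdef (1%:M : 'M[R]_p).
Proof.
by split=> [|v v0]; [rewrite trmx1|rewrite mulmx1 -/(dot v v) dot_gt0].
Qed.

Lemma cauchy_schwarz x y : `|dot x y| <= enorm x * enorm y.
Proof.
have := cauchy_schwarz_form x y sym_posdef1; rewrite !mul1mx -!sqr_enorm -exprMn.
by rewrite -[X in X <= _ -> _]real_normK ?num_real// ler_sqr// ?nnegrE mulr_ge0 ?enorm_ge0.
Qed.

Lemma enorm_le x (c : R) : 0 <= c -> dot x x <= c ^+ 2 -> enorm x <= c.
Proof.
by move=> c0; rewrite -sqr_enorm ler_sqr// nnegrE enorm_ge0.
Qed.

Lemma enormD x y : enorm (x + y) <= enorm x + enorm y.
Proof.
apply: enorm_le; first by rewrite addr_ge0 ?enorm_ge0.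
rewrite sqrrD !sqr_enorm dotDl !dotDr (dotC y x).
by have /ler_normlP[_] := cauchy_schwarz x y; lra.
Qed.

Lemma enormZ x (c : R) : enorm (c *: x) = `|c| * enorm x.
Proof.
apply/eqP; rewrite -(eqrXn2 (n := 2))// ?mulr_ge0 ?enorm_ge0//.
by rewrite exprMn !sqr_enorm dotZl dotZr real_normK ?num_real// expr2 mulrA.
Qed.

Lemma coord_le_enorm x i : `|x i ord0| <= enorm x.
Proof.
rewrite -sqrtr_sqr ler_sqrt; last first.
  by apply: sumr_ge0 => k _; exact: sqr_ge0.
by rewrite (bigD1 i)//= lerDl sumr_ge0// => k _; exact: sqr_ge0.
Qed.

Lemma enorm_mulmx A x : enorm (A *m x) <= fnorm A * enorm x.
Proof.
apply: enorm_le; first by rewrite mulr_ge0 ?sqrtr_ge0.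
rewrite exprMn /fnorm sqr_sqrtr; last first.
  by apply: sumr_ge0 => i _; apply: sumr_ge0 => j _; exact: sqr_ge0.
rewrite dotE mulr_suml; apply: ler_sum => i _.
have -> : (A *m x) i ord0 = dot (row i A)^T x.
  by rewrite mxE dotE; apply: eq_bigr => j _; rewrite !mxE.
rewrite -expr2 -real_normK ?num_real//.
apply: le_trans (_ : (enorm (row i A)^T * enorm x) ^+ 2 <= _).
  by rewrite ler_sqr ?cauchy_schwarz// nnegrE// mulr_ge0 ?enorm_ge0.
rewrite exprMn; apply: ler_wpM2r; first exact: sqr_ge0.
by rewrite sqr_enorm dotE; apply: ler_sum => j _; rewrite !mxE expr2.
Qed.

Lemma dot_mulmx_le A x : `|dot x (A *m x)| <= fnorm A * enorm x ^+ 2.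
Proof.
apply: le_trans (cauchy_schwarz _ _) _; rewrite expr2 mulrCA.
by apply: ler_wpM2l; [exact: enorm_ge0|exact: enorm_mulmx].
Qed.

Lemma sym_posdef_unit A : sym_posdef A -> A \in unitmx.
Proof.
case/sym_posdef_dot => sA pA.
rewrite -row_free_unit -kermx_eq0; apply/negPn/negP => k0.
have [i ri] : exists i, row i (kermx A) != 0.
  by apply/existsP; apply: contraR k0 => /existsPn h; apply/eqP/row_matrixP => i;
    rewrite row0; apply/eqP; have := h i; rewrite negbK.
have := pA (row i (kermx A))^T; rewrite -{1}trmx0 (inj_eq trmx_inj) => /(_ ri).
have : row i (kermx A) *m A = 0 by apply/sub_kermxP; exact: row_sub.
rewrite -{2}sA => /(congr1 trmx); rewrite trmx_mul trmx0 trmxK => h.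
by rewrite h dot0r ltxx.
Qed.

(* Cauchy-Schwarz for the form A at x and A^-1 x avoids any compactness. *)
Lemma sym_posdef_coercive A : sym_posdef A ->
  exists2 mu : R, 0 < mu & forall x, mu * dot x x <= dot x (A *m x).
Proof.
move=> pA; have uA := sym_posdef_unit pA.
pose L := fnorm (invmx A) + 1; have L0 : 0 < L by rewrite ltr_wpDl ?sqrtr_ge0.
exists L^-1; first by rewrite invr_gt0.
move=> x; have [->|x0] := eqVneq x 0; first by rewrite !dot0l mulr0.
have xx := dot_gt0 x0.
have := cauchy_schwarz_form x (invmx A *m x) pA; rewrite mulmxA mulmxV// mul1mx.
rewrite ler_pdivrMl// => h.
have h2 : dot (invmx A *m x) x <= L * dot x x.
  rewrite dotC; apply: le_trans (ler_norm _) _; apply: le_trans (dot_mulmx_le _ _) _.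
  by rewrite sqr_enorm ler_pM2r// /L lerDl.
have h3 : 0 <= dot x (A *m x) by case/sym_posdef_dot: pA => _ /(_ _ x0)/ltW.
rewrite -(ler_pM2r xx) -expr2; apply: le_trans h _.
by rewrite -mulrA mulrCA; apply: ler_wpM2l.
Qed.

(** The square of the norm contains [- 2 g <x, A x> + g^2 |A x|^2]. For [g <= mu / L] one copy of
    [g <x, A x>] absorbs the quadratic term, and the other gives [1 - mu g], which is below
    [(1 - mu g / 2)^2]; hence the rate [mu / 2]. The threshold [2 / mu] keeps [1 - m g]
    nonnegative. *)
Lemma sym_posdef_contraction A : sym_posdef A ->
  exists m g0 : R, [/\ 0 < m, 0 < g0 & forall g x, 0 < g -> g <= g0 ->
    m * g <= 1 /\ enorm (x - g *: (A *m x)) <= (1 - m * g) * enorm x].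
Proof.
move=> pA; have [mu mu0 hmu] := sym_posdef_coercive pA.
pose L := fnorm A ^+ 2 + 1; have L0 : 0 < L by rewrite ltr_wpDl ?sqr_ge0.
exists (mu / 2), (Num.min (mu / L) (2 / mu)); split; first by rewrite divr_gt0.
  by rewrite lt_min !divr_gt0.
move=> g x g0; rewrite le_min => /andP[]; rewrite ler_pdivlMr// => gL.
rewrite ler_pdivlMr// => gmu.
have mg : mu / 2 * g <= 1 by lra.
split=> //; apply: enorm_le; first by rewrite mulr_ge0 ?enorm_ge0// subr_ge0.
rewrite exprMn sqr_enorm !(dotDl, dotDr, dotNl, dotNr, dotZl, dotZr).
rewrite (dotC (A *m x) x).
have h1 := hmu x.
have h2 : dot (A *m x) (A *m x) <= L * dot x x.
  rewrite -!sqr_enorm; apply: le_trans (_ : (fnorm A * enorm x) ^+ 2 <= _).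
    by rewrite ler_sqr ?enorm_mulmx// nnegrE ?mulr_ge0 ?enorm_ge0 ?sqrtr_ge0.
  by rewrite exprMn /L; apply: ler_wpM2r; rewrite ?sqr_ge0// lerDl.
have h3 : g * (g * dot (A *m x) (A *m x)) <= g * (mu * dot x x).
  rewrite ler_pM2l//; apply: le_trans (_ : g * (L * dot x x) <= _).
    by rewrite ler_pM2l.
  by rewrite mulrA; apply: ler_wpM2r => //; exact: dot_ge0.
have h4 : g * (mu * dot x x) <= g * dot x (A *m x) by rewrite ler_pM2l.
have h5 : 0 <= (mu / 2 * g) ^+ 2 * dot x x by rewrite mulr_ge0 ?sqr_ge0 ?dot_ge0.
suff -> : (1 - mu / 2 * g) ^+ 2 * dot x x =
  dot x x - g * (mu * dot x x) + (mu / 2 * g) ^+ 2 * dot x x by lra.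
by field.
Qed.

Lemma enorm_step A x (g : R) : 0 <= g ->
  enorm (x - g *: (A *m x)) <= (1 + g * fnorm A) * enorm x.
Proof.
move=> g0; apply: le_trans (enormD _ _) _.
rewrite -scaleNr enormZ normrN ger0_norm// mulrDl mul1r lerD2l -mulrA.
by apply: ler_wpM2l => //; exact: enorm_mulmx.
Qed.

End euclid.

(** * Weights of the averaged recursion *)

Section weights.
Context {R : realType} {p : nat}.
Variables (A : 'M[R]_p) (gamma : nat -> R) (u : 'cV[R]_p).
Hypothesis gamma_gt0 : forall n, (0 < n)%N -> 0 < gamma n.
Hypothesis pA : sym_posdef A.

(** The second argument counts down from the horizon [n], which makes the backward recursion
    structural: [back_weight n i] sits at time [n - i]. The step size is part of the weight, whence
    the ratio [gamma j / gamma j.+1] and a limit that is free of [gamma]. *)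
Fixpoint back_weight (n i : nat) : 'cV[R]_p :=
  if i is k.+1 then
    let j := (n - k.+1)%N in
    gamma j *: u + (gamma j / gamma j.+1) *:
      (back_weight n k - gamma j.+1 *: (A *m back_weight n k))
  else gamma n *: u.

(* weight n j = gamma_j * sum_(j <= i <= n) prod_(j < k <= i) (1 - gamma_k A) u
   is the coefficient of the j-th noise term in sum_(1 <= i <= n) <u, Delta_i>. *)
Definition weight n j := back_weight n (n - j).

Lemma weight_nn n : weight n n = gamma n *: u.
Proof. by rewrite /weight subnn. Qed.

Lemma weight_rec n j : (j < n)%N -> weight n j = gamma j *: u +
  (gamma j / gamma j.+1) *: (weight n j.+1 - gamma j.+1 *: (A *m weight n j.+1)).
Proof.
move=> jn; rewrite /weight (_ : n - j = (n - j.+1).+1)%N; last by lia.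
by rewrite /= (_ : (n - (n - j.+1).+1)%N = j)//; lia.
Qed.

(** From time [j] on, the past enters only through [D j]. In the backward induction, substituting
    the recursion for [D j.+1] releases one noise term, and the symmetry of [A] moves [1 - gamma A]
    from the iterate to the weight, which reproduces [weight_rec]. The factor [(gamma j)^-1] undoes
    the step size stored in the weight. *)
Lemma sum_dot_weight (D N : nat -> 'cV[R]_p) n j :
  (forall k, (0 < k)%N ->
    D k = D k.-1 - gamma k *: (A *m D k.-1) + gamma k *: N k) ->
  (0 < j <= n)%N ->
  \sum_(j <= i < n.+1) dot u (D i) = (gamma j)^-1 * dot (weight n j) (D j) +
    \sum_(j.+1 <= k < n.+1) dot (weight n k) (N k).
Proof.
move=> DN /andP[j0 jn]; have [sA _] := sym_posdef_dot pA.
have [i] : exists i, (n - j = i)%N by exists (n - j)%N.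
elim: i j j0 jn => [|i IH] j j0 jn nj.
  have -> : j = n by lia.
  rewrite big_nat1 big_geq// weight_nn dotZl mulrA mulVf ?mul1r ?addr0//.
  by rewrite gt_eqF// gamma_gt0//; lia.
have jn1 : (j < n)%N by lia.
rewrite big_ltn// (IH j.+1)//; last by lia.
rewrite [in RHS]big_ltn ?ltnS// (weight_rec jn1).
have g1 : gamma j != 0 by rewrite gt_eqF// gamma_gt0.
have g2 : gamma j.+1 != 0 by rewrite gt_eqF// gamma_gt0.
rewrite [in LHS](DN j.+1)//= !(dotDl, dotDr, dotNl, dotNr, dotZl, dotZr).
rewrite (dotC (A *m _)) (dot_mulmxr A (weight n j.+1)) sA (dotC (A *m _)).
by field; rewrite g1 g2.
Qed.

(** Positivity of [gamma] starts at index 1, so the identity is applied there; unfolding [D 1] once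
    lets the first noise term join the sum and leaves only [D 0] outside. *)
Lemma sum_dot_weight1 (D N : nat -> 'cV[R]_p) n :
  (forall k, (0 < k)%N ->
    D k = D k.-1 - gamma k *: (A *m D k.-1) + gamma k *: N k) ->
  (0 < n)%N ->
  \sum_(1 <= i < n.+1) dot u (D i) =
    (gamma 1%N)^-1 * dot (weight n 1) (D 0%N - gamma 1%N *: (A *m D 0%N)) +
    \sum_(1 <= k < n.+1) dot (weight n k) (N k).
Proof.
move=> DN n0; rewrite (sum_dot_weight DN)// [in RHS]big_ltn// addrA; congr (_ + _).
rewrite (DN 1%N)//= [in LHS]dotDr dotZr mulrDr mulrA mulVf ?mul1r//.
by rewrite gt_eqF// gamma_gt0.
Qed.

Hypothesis gamma0 : gamma @ \oo --> 0.
Hypothesis dgamma0 :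
  (fun n => ((gamma n - gamma n.-1) / gamma n) / gamma n) @ \oo --> 0.

Let v := invmx A *m u.
Let e j : R := `|(gamma j.+1 - gamma j) / gamma j.+1 / gamma j.+1|.

Let e_cvg0 : e @ \oo --> 0.
Proof.
by apply/norm_cvg0P; move: dgamma0; rewrite -cvg_shiftS.
Qed.

Let ratioE j : (0 < j)%N -> `|gamma j / gamma j.+1 - 1| = e j * gamma j.+1.
Proof.
move=> j0; have g1 := gamma_gt0 (n := j.+1) isT.
rewrite /e normrM [ `|(gamma j.+1)^-1|]gtr0_norm ?invr_gt0// divfK ?gt_eqF//.
by rewrite -normrN; congr `| _ |; field; rewrite gt_eqF.
Qed.

(** Since [A *m v = u], the vector [v] is a fixed point of the recursion whenever two consecutive
    step sizes agree; only [gamma j / gamma j.+1 - 1] drives the deviation. *)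
Let d_rec n j : (0 < j < n)%N -> weight n j - v =
  (gamma j / gamma j.+1 - 1) *: v + (gamma j / gamma j.+1) *:
   ((weight n j.+1 - v) - gamma j.+1 *: (A *m (weight n j.+1 - v))).
Proof.
case/andP=> j0 jn; rewrite weight_rec// mulmxBr {4}/v mulmxA mulmxV ?sym_posdef_unit//.
rewrite mul1mx; have g1 := gamma_gt0 (n := j.+1) isT.
move: (weight n j.+1) => w; apply/matrixP => r s; rewrite !mxE.
by field; rewrite gt_eqF.
Qed.

Lemma weight_limit :
  (exists2 B : R, 0 <= B & forall n j, (0 < j <= n)%N -> enorm (weight n j - v) <= B) /\
  (fun n => n%:R^-1 * \sum_(1 <= j < n.+1) enorm (weight n j - v)) @ \oo --> 0.
Proof.
have [m [g0 [m0 g00 contr]]] := sym_posdef_contraction pA.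
have [G HG] : exists G, forall n, `|gamma n| <= G.
  have [G [_ HG]] := cvg_seq_bounded (cvgP _ gamma0).
  by exists (G + 1) => n; apply: (HG (G + 1) _ n I); rewrite ltrDl.
(* With [e j <= 1], the bound [2^-1] keeps the ratio [gamma j / gamma j.+1] above 1/2; this is the
   origin of the factor 2 in [ge]. *)
have c1 : 0 < Num.min g0 2^-1 by rewrite lt_min g00 invr_gt0 ltr0n.
have [J1 HJ1] := eventually_le gamma0 c1.
(* Half of the contraction rate pays for the ratio, which is at most [1 + m g / 2]: indeed
   [(1 + m g / 2) (1 - m g) <= 1 - m g / 2]. The backward lemmas are therefore used at rate
   [m / 2]. *)
have c2 : 0 < Num.min 1 (m / 2) by rewrite lt_min divr_gt0 ?ltr01.
have [J2 HJ2] := eventually_le e_cvg0 c2.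
pose J := (maxn J1 J2).+1.
have gJ j : (J <= j)%N -> gamma j.+1 <= g0 /\ gamma j.+1 <= 2^-1.
  rewrite gtn_max => /andP[j1 j2]; have := HJ1 j.+1 ltac:(lia).
  by rewrite le_min => /andP[h1 h2]; split; exact: le_trans (ler_norm _) _.
have eJ j : (J <= j)%N -> e j <= 1 /\ e j <= m / 2.
  rewrite gtn_max => /andP[j1 j2]; have := HJ2 j ltac:(lia).
  by rewrite le_min => /andP[h1 h2]; split; exact: le_trans (ler_norm _) _.
have e0 j : 0 <= e j by exact: normr_ge0.
have m20 : 0 < m / 2 by rewrite divr_gt0.
(* A crude growth factor for the times before [J]. Absolute values make it nonnegative at [j = 0]
   too, where the sign of [gamma] is unknown. *)
pose kap j := e j * `|gamma j.+1| * enorm v +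
  `|gamma j / gamma j.+1| * (1 + `|gamma j.+1| * fnorm A).
have fA0 : 0 <= fnorm A by exact: sqrtr_ge0.
have kap0 j : 0 <= kap j.
  by rewrite addr_ge0 ?mulr_ge0 ?enorm_ge0 ?addr_ge0// mulr_ge0.
have mg1 j : (J <= j)%N -> m / 2 * gamma j.+1 <= 1.
  move=> Jj; have [h1 _] := gJ _ Jj; have gp := gamma_gt0 (n := j.+1) isT.
  have [+ _] := contr _ 0 gp h1; have : 0 < m * gamma j.+1 by rewrite mulr_gt0.
  lra.
have a0 n j : 0 <= enorm (weight n j - v) by exact: enorm_ge0.
have an n : (0 < n)%N -> enorm (weight n n - v) <= G * enorm u + enorm v.
  move=> _; rewrite weight_nn; apply: le_trans (enormD _ _) _.
  rewrite -scaleN1r !enormZ normrN normr1 mul1r lerD2r.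
  by apply: ler_wpM2r => //; exact: enorm_ge0.
have rho0 j : (0 < j)%N -> 0 < gamma j / gamma j.+1.
  by move=> j0; rewrite divr_gt0 ?gamma_gt0.
have astep n j : (J <= j < n)%N -> enorm (weight n j - v) <=
    e j * gamma j.+1 * enorm v + (1 - m / 2 * gamma j.+1) * enorm (weight n j.+1 - v).
  case/andP => Jj jn; have j0 : (0 < j)%N by lia.
  have gp := gamma_gt0 (n := j.+1) isT.
  rewrite d_rec ?j0//; apply: le_trans (enormD _ _) _.
  rewrite !enormZ ratioE// lerD2l (gtr0_norm (rho0 _ j0)).
  have [h1 h2] := gJ _ Jj; have [h3 h4] := eJ _ Jj.
  have [h5 h6] := contr _ (weight n j.+1 - v) gp h1.
  apply: le_trans (ler_wpM2l (ltW (rho0 _ j0)) h6) _.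
  rewrite mulrA; apply: ler_wpM2r => //.
  have : gamma j / gamma j.+1 <= 1 + m / 2 * gamma j.+1.
    have := ratioE j0; have : e j * gamma j.+1 <= m / 2 * gamma j.+1 by rewrite ler_pM2r.
    by have := ler_norm (gamma j / gamma j.+1 - 1); lra.
  have h7 : 0 <= 1 - m * gamma j.+1 by lra.
  move=> /(ler_wpM2r h7) h8; apply: le_trans h8 _.
  have : 0 <= (m * gamma j.+1) * (m * gamma j.+1) by rewrite mulr_ge0// ltW// mulr_gt0.
  lra.
have akap n j : (0 < j < n)%N -> enorm (weight n j - v) <=
    kap j * (1 + enorm (weight n j.+1 - v)).
  move=> /andP[j0 jn]; have gp := gamma_gt0 (n := j.+1) isT.
  rewrite d_rec ?j0//; apply: le_trans (enormD _ _) _.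
  rewrite !enormZ ratioE// /kap (gtr0_norm gp) (gtr0_norm (rho0 _ j0)).
  have := ler_wpM2l (ltW (rho0 _ j0)) (enorm_step A (weight n j.+1 - v) (ltW gp)).
  move=> h; apply: le_trans (lerD (lexx _) h) _.
  have b0 := a0 n j.+1; have r0 := rho0 _ j0.
  have h1 : 0 <= e j * gamma j.+1 * enorm v by rewrite !mulr_ge0 ?enorm_ge0// ltW.
  have h2 : 0 <= gamma j / gamma j.+1 * (1 + gamma j.+1 * fnorm A).
    by apply: mulr_ge0; [exact: ltW|rewrite addr_ge0// mulr_ge0// ltW].
  have := mulr_ge0 h1 b0.
  move: h1 h2; set X := e j * _ * _; set Y := gamma j / gamma j.+1 * _.
  by rewrite mulrA -/Y => h1 h2 h3; rewrite mulrDr mulr1 mulrDl; lra.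
have ge j : (J <= j)%N -> `|(gamma j)^-1 - (gamma j.+1)^-1| <= 2 * e j.
  move=> Jj; have j0 : (0 < j)%N by lia.
  have gp := gamma_gt0 j0; have gp1 := gamma_gt0 (n := j.+1) isT.
  have [_ h2] := gJ _ Jj; have [h3 _] := eJ _ Jj.
  have -> : (gamma j)^-1 - (gamma j.+1)^-1 =
    (gamma j.+1 - gamma j) / gamma j.+1 / gamma j.+1 * (gamma j.+1 / gamma j).
    by field; rewrite !gt_eqF.
  rewrite normrM -/(e j) mulrC; apply: ler_wpM2r => //.
  rewrite gtr0_norm ?divr_gt0// ler_pdivrMr//.
  have := ratioE j0; have : e j * gamma j.+1 <= 1 * 2^-1 by apply: ler_pM => //; exact: ltW.
  move=> h4 h5; have := ler_norm (- (gamma j / gamma j.+1 - 1)); rewrite normrN h5.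
  rewrite opprB => h6; have : 2^-1 <= gamma j / gamma j.+1 by lra.
  by rewrite ler_pdivlMr//; lra.
have e1 j : (J <= j)%N -> 0 <= e j <= 1 by move=> /eJ[-> _]; rewrite e0.
have J0 : (0 < J)%N by [].
split.
  exact: (backward_bounded m20 (enorm_ge0 v) J0 gamma_gt0 mg1 e1 a0 an astep kap0 akap).
exact: (backward_mean_cvg0 m20 (enorm_ge0 v) J0 gamma_gt0 mg1 e1 a0 an astep kap0
  akap ge e_cvg0 e0).
Qed.

End weights.

(** * Density of trigonometric polynomials *)

Section trigonometric_polynomials.
Context {R : realType} {p : nat}.
Implicit Types (u x y : 'cV[R]_p) (f g : 'cV[R]_p -> R).

(** The free phase [th] makes cosines alone sufficient: constants are the case [u = 0], sines are
    shifted cosines, and products stay in the class by the product-to-sum formula. *)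
Inductive trigpoly : ('cV[R]_p -> R) -> Prop :=
| trig_cos (a : R) u (th : R) : trigpoly (fun x => a * cos (dot u x + th))
| trig_add f g : trigpoly f -> trigpoly g -> trigpoly (fun x => f x + g x).

Lemma trig_ext f g : f =1 g -> trigpoly f -> trigpoly g.
Proof. by move=> /funext ->. Qed.

Lemma trig_cst (c : R) : trigpoly (fun=> c).
Proof.
by apply: (trig_ext _ (trig_cos c 0 0)) => x; rewrite dot0l addr0 cos0 mulr1.
Qed.

Lemma trig_mul f g : trigpoly f -> trigpoly g -> trigpoly (fun x => f x * g x).
Proof.
move=> tf tg; elim: tf => [a u th|f1 f2 _ IH1 _ IH2]; last first.
  by apply: (trig_ext _ (trig_add IH1 IH2)) => x; rewrite mulrDl.
elim: tg => [b w ph|g1 g2 _ IH1 _ IH2]; last first.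
  by apply: (trig_ext _ (trig_add IH1 IH2)) => x; rewrite mulrDr.
apply: (trig_ext _ (trig_add (trig_cos (a * b / 2) (u + w) (th + ph))
  (trig_cos (a * b / 2) (u - w) (th - ph)))) => x.
rewrite !dotDl dotNl.
rewrite (_ : dot u x + dot w x + _ = (dot u x + th) + (dot w x + ph)); last by ring.
rewrite (_ : dot u x - dot w x + _ = (dot u x + th) - (dot w x + ph)); last by ring.
by rewrite cosD cosB; field.
Qed.

Lemma trig_bounded f : trigpoly f -> exists2 B : R, 0 <= B & forall x, `|f x| <= B.
Proof.
elim=> [a u th|{}f g _ [B B0 HB] _ [C C0 HC]].
  by exists `|a| => // x; rewrite normrM ler_piMr// cos_max.
exists (B + C) => [|x]; first by rewrite addr_ge0.
by rewrite (le_trans (ler_normD _ _))// lerD.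
Qed.

(** Uniformity is over the whole space, not over a box: this survives products because trigonometric
    polynomials are bounded, and it later gives a global bound on the approximant. *)
Definition trig_approx f :=
  forall e : R, 0 < e -> exists2 q, trigpoly q & forall x, `|f x - q x| <= e.

Lemma trig_approx_trig f : trigpoly f -> trig_approx f.
Proof. by move=> tf e e0; exists f => // x; rewrite subrr normr0 ltW. Qed.

Lemma trig_approx_lim f : (forall e : R, 0 < e ->
  exists2 q, trig_approx q & forall x, `|f x - q x| <= e) -> trig_approx f.
Proof.
move=> h e e0; have e2 : 0 < e / 2 by rewrite divr_gt0.
have [q aq fq] := h _ e2; have [r tr qr] := aq _ e2; exists r => // x.
rewrite (_ : f x - r x = (f x - q x) + (q x - r x)); last by ring.
by rewrite (le_trans (ler_normD _ _))// [leRHS]splitr lerD.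
Qed.

Lemma trig_approx_bounded f : trig_approx f ->
  exists2 B : R, 0 <= B & forall x, `|f x| <= B.
Proof.
move=> /(_ 1 ltr01)[q /trig_bounded[B B0 HB] fq].
exists (B + 1) => [|x]; first by rewrite addr_ge0.
rewrite (_ : f x = q x + (f x - q x)); last by ring.
by rewrite (le_trans (ler_normD _ _))// lerD.
Qed.

Lemma trig_approx_add f g : trig_approx f -> trig_approx g ->
  trig_approx (fun x => f x + g x).
Proof.
move=> af ag e e0; have e2 : 0 < e / 2 by rewrite divr_gt0.
have [q tq fq] := af _ e2; have [r tr gr] := ag _ e2.
exists (fun x => q x + r x); first exact: trig_add.
move=> x; rewrite (_ : _ - _ = (f x - q x) + (g x - r x)); last by ring.
by rewrite (le_trans (ler_normD _ _))// [leRHS]splitr lerD.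
Qed.

Lemma trig_approx_mul f g : trig_approx f -> trig_approx g ->
  trig_approx (fun x => f x * g x).
Proof.
move=> af ag e e0; have [B B0 HB] := trig_approx_bounded af.
have B1 : 0 < B + 1 by rewrite ltr_wpDl.
have e1 : 0 < e / 2 / (B + 1) by rewrite !divr_gt0.
have [r tr gr] := ag _ e1; have [C C0 HC] := trig_bounded tr.
have C1 : 0 < C + 1 by rewrite ltr_wpDl.
have e2 : 0 < e / 2 / (C + 1) by rewrite !divr_gt0.
have [q tq fq] := af _ e2.
exists (fun x => q x * r x); first exact: trig_mul.
move=> x; rewrite (_ : _ - _ = f x * (g x - r x) + r x * (f x - q x)); last by ring.
rewrite (le_trans (ler_normD _ _))// [leRHS]splitr !normrM lerD//.
  rewrite (le_trans (ler_pM _ _ (HB x) (gr x)))//.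
  by rewrite mulrCA ler_piMr ?divr_ge0 ?ltW// ltr_pdivrMr ?mul1r ?ltrDl.
rewrite (le_trans (ler_pM _ _ (HC x) (fq x)))//.
by rewrite mulrCA ler_piMr ?divr_ge0 ?ltW// ltr_pdivrMr ?mul1r ?ltrDl.
Qed.

Lemma trig_approx_cst (c : R) : trig_approx (fun=> c).
Proof. exact/trig_approx_trig/trig_cst. Qed.

Lemma trig_approx_scale (c : R) f : trig_approx f -> trig_approx (fun x => c * f x).
Proof. exact/trig_approx_mul/trig_approx_cst. Qed.

(* Polynomials in t that increase to |t|, uniformly on [-1, 1]. *)
Fixpoint abs_iter (n : nat) (t : R) : R :=
  if n is k.+1 then abs_iter k t + (t ^+ 2 - abs_iter k t ^+ 2) / 2 else 0.

(** Only [t ^+ 2] enters, so [t] may be replaced by [s = |t|]. One step multiplies the gap [s - q]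
    by [1 - (s + q) / 2], a contraction that degenerates near 0; the stated inequality is preserved
    by it and yields a gap of at most [2 / n] uniformly. *)
Lemma abs_iter_bound n (t : R) : `|t| <= 1 ->
  0 <= abs_iter n t <= `|t| /\ (`|t| - abs_iter n t) * (2 + n%:R * `|t|) <= 2 * `|t|.
Proof.
have -> : abs_iter n t = abs_iter n `|t|.
  by elim: n => //= n ->; rewrite real_normK ?num_real.
move: `|t| (normr_ge0 t) => {t} s s0 s1.
elim: n => [|n [/andP[q0 qs] IH]] /=; first by rewrite lexx s0 subr0 mul0r addr0 mulrC.
move: (abs_iter n s) q0 qs IH => q q0 qs IH.
have es : s - (q + (s ^+ 2 - q ^+ 2) / 2) = (s - q) * (1 - (s + q) / 2) by field.
have h1 : 0 <= (s - q) * (1 - (s + q) / 2) by rewrite mulr_ge0//; lra.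
have h2 : 0 <= (s - q) * (s + q) by rewrite mulr_ge0//; lra.
split; first by apply/andP; split; [rewrite subr_sqr|rewrite -subr_ge0 es]; lra.
rewrite es -natr1; move: (ler0n R n) => n0; apply: le_trans IH.
rewrite -mulrA; apply: ler_wpM2l; first by rewrite subr_ge0.
have h3 : 0 <= q * (2 + (n%:R + 1) * s).
  by rewrite mulr_ge0// addr_ge0// mulr_ge0// addr_ge0.
have h4 : 0 <= n%:R * (s * s) by rewrite !mulr_ge0.
have h5 : 0 <= s * s by rewrite mulr_ge0.
rewrite -subr_ge0 (_ : _ - _ = (q * (2 + (n%:R + 1) * s) + n%:R * (s * s) + s * s) / 2).
  by lra.
by field.
Qed.

Lemma trig_approx_abs f : trig_approx f -> trig_approx (fun x => `|f x|).
Proof.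
(* It suffices to treat functions with values in [-1, 1], where [abs_iter] converges; the general
   case follows on dividing by [B + 1], which is positive even if [B = 0]. *)
suff H g : trig_approx g -> (forall x, `|g x| <= 1) -> trig_approx (fun x => `|g x|).
  move=> af; have [B B0 HB] := trig_approx_bounded af.
  have B1 : 0 < B + 1 by rewrite ltr_wpDl.
  have := H _ (trig_approx_scale (B + 1)^-1 af).
  have /[swap] /[apply] : forall x, `|(B + 1)^-1 * f x| <= 1.
    move=> x; rewrite normrM gtr0_norm ?invr_gt0// ler_pdivrMl// mulr1.
    by rewrite (le_trans (HB x))// lerDl.
  move=> /(trig_approx_scale (B + 1)); congr trig_approx; apply/funext => x.
  by rewrite normrM gtr0_norm ?invr_gt0// mulrA mulfV ?mul1r// gt_eqF.
move=> ag g1; apply: trig_approx_lim => e e0.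
pose n := (Num.truncn (2 / e)).+1.
have ne : 2 / e < n%:R by rewrite /n truncnS_gt// divr_ge0 ?ltW.
exists (fun x => abs_iter n (g x)).
  elim: n {ne} => [|n IH] /=; first exact: trig_approx_cst.
  have := trig_approx_mul ag ag; have := trig_approx_mul IH IH.
  move=> /(trig_approx_scale (-1)) /[swap] /trig_approx_add /[apply].
  move=> /(trig_approx_scale 2^-1) /(trig_approx_add IH).
  by congr trig_approx; apply/funext => x; field.
move=> x; have [/andP[q0 qs] h] := abs_iter_bound n (g1 x).
rewrite ger0_norm ?subr_ge0//.
have [s0|s0] := eqVneq `|g x| 0; first by move: qs; rewrite s0 => qs; lra.
have {}s0 : 0 < `|g x| by rewrite lt_neqAle eq_sym s0 normr_ge0.
have n0 : 0 < n%:R :> R by rewrite ltr0n.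
have h2 : (`|g x| - abs_iter n (g x)) * n%:R <= 2.
  rewrite -(ler_pM2r s0); apply: le_trans h; rewrite -mulrA.
  by apply: ler_wpM2l; rewrite ?subr_ge0// lerDr.
move: ne; rewrite ltr_pdivrMr// => ne.
by rewrite -(ler_pM2r n0); apply: le_trans h2 _; rewrite mulrC ltW.
Qed.

Lemma trig_approx_min f g : trig_approx f -> trig_approx g ->
  trig_approx (fun x => Num.min (f x) (g x)).
Proof.
move=> af ag; have := trig_approx_add af (trig_approx_scale (-1) ag).
move=> /trig_approx_abs /(trig_approx_scale (-1)) h.
have := trig_approx_scale 2^-1 (trig_approx_add (trig_approx_add af ag) h).
congr trig_approx; apply/funext => x; rewrite !mulN1r.
have [fg|fg] := leP (f x) (g x).
  by rewrite ler0_norm ?subr_le0//; field.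
by rewrite gtr0_norm ?subr_gt0//; field.
Qed.

End trigonometric_polynomials.

(** * Uniform approximation on boxes *)

Section density.
Context {R : realType} {p : nat}.
Implicit Types (u x y : 'cV[R]_p) (f g : 'cV[R]_p -> R) (L : R).

Definition box (L : R) : set 'cV[R]_p := [set x | forall i, `|x i ord0| <= L].

Lemma trmx_continuous m n : continuous (@trmx R m n).
Proof.
move=> M A [/= Q MQ QA]; exists (fun i j => Q j i) => [i j|N NQ].
  by have := MQ j i; rewrite mxE.
by apply: QA => i j; rewrite mxE; exact: NQ.
Qed.

Lemma box_compact L : compact (box L).
Proof.
have -> : box L = @trmx R 1 p @` [set v : 'rV[R]_p | forall i, `[- L, L]%classic (v ord0 i)].
  apply/seteqP; split => x /=.
    move=> xL; exists x^T; last by rewrite trmxK.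
    by move=> i; rewrite /= mxE in_itv/= -ler_norml.
  by move=> [y yL <-] i; rewrite mxE ler_norml; have := yL i; rewrite /= in_itv.
apply: continuous_compact.
  by apply: continuous_subspaceT; exact: trmx_continuous.
by apply: (@rV_compact R p (fun=> `[- L, L]%classic)) => i; exact: segment_compact.
Qed.

(** A stand-in for the squared distance that is itself a trigonometric polynomial in [x]. *)
Definition trig_dist (L : R) x y : R :=
  \sum_i (1 - cos ((x i ord0 - y i ord0) / L)).

Lemma trig_dist_ge0 L x y : 0 <= trig_dist L x y.
Proof. by apply: sumr_ge0 => i _; rewrite subr_ge0 cos_le1. Qed.

(** At scale [2 * L] all angles lie in [-1, 1], where [sin] vanishes only at 0, so [cos z = 1]
    forces [z = 0]. *)
Lemma trig_dist_eq0 L x y : 0 < L -> box L x -> box L y ->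
  trig_dist (2 * L) x y = 0 -> x = y.
Proof.
move=> L0 xL yL /eqP; rewrite psumr_eq0 => [/allP h|i _]; last first.
  by rewrite subr_ge0 cos_le1.
apply/matrixP => i j; rewrite ord1; apply/eqP; rewrite -subr_eq0.
have /= /eqP := h i (mem_index_enum _).
set z := (x i ord0 - y i ord0) / (2 * L) => cz0.
have cz : cos z = 1 by lra.
have z1 : `|z| <= 1.
  rewrite normrM [X in _ * X <= _]gtr0_norm ?invr_gt0 ?mulr_gt0//.
  rewrite ler_pdivrMr ?mulr_gt0// mul1r; apply: le_trans (ler_normB _ _) _.
  by have := xL i; have := yL i; lra.
have z0 : z == 0.
  apply/negPn/negP => z0.
  have /sin2_gt0 : 0 < `|z| < 2 by rewrite normr_gt0 z0; lra.
  have := cos2Dsin2 `|z|; rewrite cos_norm cz expr1n => h1.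
  have : sin `|z| ^+ 2 = 0 by lra.
  by move=> /eqP; rewrite sqrf_eq0 => /eqP ->; rewrite ltxx.
move: z0; rewrite /z mulf_eq0 invr_eq0 mulf_eq0 (gt_eqF L0) orbF.
by rewrite pnatr_eq0/= orbF.
Qed.

Lemma trig_dist_continuous L :
  continuous (fun z : 'cV[R]_p * 'cV[R]_p => trig_dist L z.1 z.2).
Proof.
move=> z; apply: cvg_big => [|i _]; first exact: add_continuous.
apply: cvgB; first exact: cvg_cst.
apply: continuous_cvg; first exact: continuous_cos.
apply: cvgMr_tmp; apply: cvgB.
  by apply: (continuous_cvg _ (@coord_continuous _ _ _ i ord0 _)); exact: cvg_fst.
by apply: (continuous_cvg _ (@coord_continuous _ _ _ i ord0 _)); exact: cvg_snd.
Qed.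

Lemma trigpoly_dist L y : trigpoly (fun x => trig_dist L x y).
Proof.
rewrite /trig_dist; elim: (index_enum _) => [|i s IH].
  by apply: (trig_ext _ (trig_cst 0)) => x; rewrite big_nil.
have ti : trigpoly (fun x => 1 - cos ((x i ord0 - y i ord0) / L)).
  apply: (trig_ext _ (trig_add (trig_cst 1) (trig_cos (-1) (L^-1 *: delta_mx i ord0)
    (- (y i ord0 / L))))) => x.
  by rewrite mulN1r dotZl dot_delta mulrBl mulrC.
by apply: (trig_ext _ (trig_add ti IH)) => x; rewrite big_cons.
Qed.

Lemma foldr_min_le (s : seq 'cV[R]_p) (h : 'cV[R]_p -> R) (B : R) y :
  y \in s -> foldr (fun z acc => Num.min (h z) acc) B s <= h y.
Proof.
elim: s => //= z s IH; rewrite inE => /predU1P[->|/IH ys]; first by rewrite ge_min lexx.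
by rewrite ge_min ys orbT.
Qed.

Lemma foldr_min_ge (s : seq 'cV[R]_p) (h : 'cV[R]_p -> R) (B c : R) :
  c <= B -> (forall z, z \in s -> c <= h z) ->
  c <= foldr (fun z acc => Num.min (h z) acc) B s.
Proof.
move=> cB; elim: s => //= z s IH hs; rewrite le_min hs ?mem_head//=.
by apply: IH => w ws; apply: hs; rewrite inE ws orbT.
Qed.

Lemma foldr_min_ub (s : seq 'cV[R]_p) (h : 'cV[R]_p -> R) (B : R) :
  foldr (fun z acc => Num.min (h z) acc) B s <= B.
Proof. by elim: s => //= z s IH; rewrite ge_min IH orbT. Qed.

Lemma continuous_affine2 (T : topologicalType) (a b : T -> R) (c c' M : R) :
  continuous a -> continuous b -> continuous (fun t => a t + c - (c' + M * b t)).
Proof.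
move=> ca cb t; apply: cvgB; first by apply: cvgD; [exact: ca|exact: cvg_cst].
by apply: cvgD; [exact: cvg_cst|apply: cvgMl_tmp; exact: cb].
Qed.

Lemma continuous_fst (T U V : topologicalType) (h : T * U -> V) (y : U) :
  continuous h -> continuous (fun t => h (t, y)).
Proof.
move=> ch t; apply: (cvg_comp (fun t => (t, y)) h (G := nbhs (t, y))); last exact: ch.
by apply: cvg_pair; [exact: cvg_id|exact: cvg_cst].
Qed.

(* On the box, f is uniformly close to the finite infimum over y of
   f y + M * trig_dist x y, which only needs the lattice operations. *)
Lemma trig_dense f (B L e : R) : continuous f -> (forall x, `|f x| <= B) ->
  0 < L -> 0 < e ->
  exists2 g, trigpoly g & (forall x, `|g x| <= B + e) /\
    (forall x, box L x -> `|f x - g x| <= e).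
Proof.
(* On the box the finite infimum will lie between [f - d] and [f + 2 * d], and its trigonometric
   approximation costs another [d]. *)
move=> cf fB L0 e0; pose d := e / 3; have d0 : 0 < d by rewrite divr_gt0.
pose rho := trig_dist (2 * L).
have rho0 x y : 0 <= rho x y by exact: trig_dist_ge0.
have B0 : 0 <= B by exact: le_trans (fB 0).
(* A modulus of continuity in terms of [rho]: where [rho] vanishes the two points agree, elsewhere a
   large [M] beats the oscillation [2 * B]. The condition is open and monotone in [n], so
   compactness of the product of boxes yields one [M] for all pairs. *)
have [M M0 HM] : exists2 M : R, 0 <= M & forall x y, box L x -> box L y ->
    f x - f y <= d + M * rho x y.
  have : compact (box L `*` box L).
    by apply: compact_setX; exact: box_compact.
  move=> /compact_near_coveringP /(_ nat \oo
    (fun n z => 0 < d + n%:R * rho z.1 z.2 - (f z.1 - f z.2)) _) [].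
    move=> [x y] /= [xL yL].
    have [n hn] : exists n : nat, 0 < d + n%:R * rho x y - (f x - f y).
      have [r0|r0] := eqVneq (rho x y) 0.
        have -> := trig_dist_eq0 L0 xL yL r0.
        by exists 0%N => //=; rewrite subrr mul0r addr0 subr0.
      have {}r0 : 0 < rho x y by rewrite lt_neqAle eq_sym r0 rho0.
      exists (Num.truncn (2 * B / rho x y)).+1 => //=.
      have := @truncnS_gt R (2 * B / rho x y).
      rewrite ltr_pdivrMr//; set n := _%:R => h.
      have := fB x; have := fB y; rewrite !ler_norml => /andP[h1 h2] /andP[h3 h4].
      by lra.
    exists ([set z | 0 < d + n%:R * rho z.1 z.2 - (f z.1 - f z.2)],
            [set m | (n <= m)%N]); last first.
      move=> [z m] /= [hz nm]; apply: lt_le_trans hz _.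
      by rewrite lerD2r lerD2l ler_wpM2r// ler_nat.
    split; last by exists n.
    apply: (@open_nbhs_nbhs _ (x, y)); split=> //.
    apply: (@open_comp _ _ (fun z : 'cV[R]_p * 'cV[R]_p =>
      d + n%:R * rho z.1 z.2 - (f z.1 - f z.2)) [set r | 0 < r]).
      move=> z _; apply: cvgB; first apply: cvgD; first exact: cvg_cst.
        by apply: cvgMl_tmp; exact: trig_dist_continuous.
      apply: cvgB; apply: (continuous_cvg _ (cf _)); [exact: cvg_fst|exact: cvg_snd].
    exact: open_gt.
  move=> m _ /(_ m (leqnn m)) Hm; exists m%:R => // x y xL yL.
  by have /= := Hm (x, y) (conj xL yL); lra.
(* Each [y] in the box belongs to its own open set because [rho y y = 0]; compactness leaves
   finitely many centres. *)
have [D DK HD] : exists2 D : {fset 'cV[R]_p}, {subset D <= box L} &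
    forall x, box L x -> exists2 y, y \in D & f y + M * rho x y <= f x + 2 * d.
  have : compact (box L) by exact: box_compact.
  rewrite compact_cover => /(_ _ (box L) (fun y =>
    [set x | 0 < f x + 2 * d - (f y + M * rho x y)])).
  case=> [y yL|x xL /=|D DL HD].
  - have cg : continuous (fun x => f x + 2 * d - (f y + M * rho x y)).
      apply: continuous_affine2 => // x.
      by apply: (continuous_fst (h := fun z => rho z.1 z.2)); exact: trig_dist_continuous.
    apply: (@open_comp _ _ (fun x => f x + 2 * d - (f y + M * rho x y)) [set r | 0 < r]) => [x _|].
      exact: cg.
    exact: open_gt.
  - exists x => //=; rewrite /rho /trig_dist big1 ?mulr0 ?addr0; last first.
      by move=> i _; rewrite subrr mul0r cos0 subrr.
    by rewrite addrC addKr mulr_gt0.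
  exists D => // x xL; have [y yD /= h] := HD x xL; exists y => //; lra.
(* Starting the fold from [B] caps [g] at [B] on the whole space, also when [D] is empty; the cap
   does no harm since [f <= B]. *)
pose g x := foldr (fun y acc => Num.min (f y + M * rho x y) acc) B (enum_fset D).
have ag : trig_approx g.
  rewrite /g; elim: (enum_fset D) => [|y s IH] /=; first exact: trig_approx_cst.
  apply: trig_approx_min => //; apply: trig_approx_add; first exact: trig_approx_cst.
  by apply: trig_approx_scale; apply: trig_approx_trig; exact: trigpoly_dist.
have [q tq gq] := ag _ d0.
exists q => //; split => x.
  have g1 : `|g x| <= B.
    rewrite ler_norml foldr_min_ub andbT; apply: foldr_min_ge.
      by rewrite (le_trans _ B0)// oppr_le0.
    move=> y _; have : 0 <= M * rho x y by rewrite mulr_ge0.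
    by have := fB y; rewrite ler_norml => /andP[h1 h2] h3; lra.
  have h1 := gq x; rewrite (_ : q x = g x - (g x - q x)); last by ring.
  by rewrite (le_trans (ler_normB _ _))//; rewrite /d in h1; lra.
move=> xL; have h1 := gq x.
have h2 : f x - d <= g x.
  apply: foldr_min_ge; first by have := ler_norm (f x); have := fB x; lra.
  by move=> y yD; have := HM x y xL (set_mem (DK y yD)); lra.
have [y yD h4] := HD x xL.
have h3 : g x <= f x + 2 * d by apply: le_trans (foldr_min_le _ _ yD) _.
rewrite (_ : f x - q x = (f x - g x) + (g x - q x)); last by ring.
rewrite (le_trans (ler_normD _ _))//.
have : `|f x - g x| <= 2 * d by rewrite ler_norml; apply/andP; split; lra.
by rewrite /d in h1 *; lra.
Qed.

End density.

(** * Trigonometric bounds and expectations *)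

Section trigonometric_bounds.
Context {R : realType}.
Implicit Types x y : R.

Lemma normr_sin_le y : `|sin y| <= `|y|.
Proof.
wlog y0 : y / 0 <= y.
  move=> h; have [/h//|/ltW y0] := leP 0 y.
  by have := h (- y); rewrite sinN !normrN => ->//; rewrite oppr_ge0.
have [c _] : exists2 c, c \in `[0, y] & sin y - sin 0 = cos c * (y - 0).
  apply: MVT_segment => //.
  by apply: continuous_subspaceT; exact: continuous_sin.
by rewrite sin0 !subr0 => ->; rewrite normrM ler_piMl// cos_max.
Qed.

Lemma one_sub_cos y : 1 - cos y = 2 * sin (y / 2) ^+ 2.
Proof.
have : cos y = cos ((y / 2) *+ 2) by congr cos; rewrite mulr2n; field.
by rewrite cos_mulr2n => ->; have := cos2Dsin2 (y / 2); lra.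
Qed.

(** Mean value theorem for [sin x - x], whose derivative is [- 2 sin(c / 2)^2]. The constant is not
    sharp; only the cubic order matters. *)
Lemma normr_sin_sub y : `|sin y - y| <= `|y| ^+ 3.
Proof.
wlog y0 : y / 0 <= y.
  move=> h; have [/h//|/ltW y0] := leP 0 y.
  have := h (- y); rewrite oppr_ge0 => /(_ y0); rewrite sinN normrN.
  by rewrite -opprB normrN opprK [X in `|X| <= _ -> _]addrC.
have [c c0y] : exists2 c, c \in `[0, y] &
    (sin y - y) - (sin 0 - 0) = (cos c - 1) * (y - 0).
  apply: (@MVT_segment R (fun x => sin x - x) (fun x => cos x - 1)) => //.
  apply: continuous_subspaceT => x; apply: cvgB; last exact: cvg_id.
  exact: continuous_sin.
rewrite sin0 !subr0 => ->; rewrite normrM -opprB normrN one_sub_cos.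
rewrite [leRHS]exprSr; apply: ler_wpM2r => //.
have /andP[c0 cy] : 0 <= c <= y by move: c0y; rewrite in_itv.
have h : sin (c / 2) ^+ 2 <= (c / 2) ^+ 2.
  by rewrite -ler_sqrt ?sqr_ge0// !sqrtr_sqr normr_sin_le.
have : c ^+ 2 <= y ^+ 2 by rewrite ler_sqr ?nnegrE//.
rewrite (ger0_norm y0) (ger0_norm (mulr_ge0 (ler0n _ 2) (sqr_ge0 _))) => h1.
by move: h; rewrite expr_div_n => h; have := sqr_ge0 c; lra.
Qed.

(** By the half-angle formula the left side is twice the difference of the squares of [y / 2] and
    [sin (y / 2)]; one factor is of cubic order and the other linear. *)
Lemma normr_cos_sub y : `|cos y - 1 + y ^+ 2 / 2| <= y ^+ 4 / 4.
Proof.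
have -> : cos y - 1 + y ^+ 2 / 2 = 2 * ((y / 2 - sin (y / 2)) * (y / 2 + sin (y / 2))).
  by have := one_sub_cos y; rewrite -subr_sqr expr_div_n; lra.
set z := y / 2; rewrite normrM normr_nat normrM distrC.
have h1 := normr_sin_sub z.
have h2 : `|z + sin z| <= 2 * `|z|.
  by rewrite (le_trans (ler_normD _ _))//; have := normr_sin_le z; lra.
have -> : y ^+ 4 / 4 = 2 * (`|z| ^+ 3 * (2 * `|z|)).
  have -> : y ^+ 4 = 16 * `|z| ^+ 4.
    by rewrite -normrX ger0_norm ?exprn_even_ge0// /z; field.
  by field.
by rewrite ler_pM2l// ler_pM.
Qed.

(** [1 + y <= expR y] gives [expR (- y) * (1 + y) <= 1]; the claim follows after multiplying by
    [1 + y]. *)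
Lemma normr_expRN_sub y : 0 <= y -> `|1 - y - expR (- y)| <= y ^+ 2.
Proof.
move=> y0; have h1 := expR_ge1Dx (- y); have h2 := expR_ge1Dx y.
rewrite ler0_norm; last by lra.
have h3 : expR (- y) * (1 + y) <= 1.
  rewrite -[leRHS](expR0 R) -[X in _ <= expR X](addNr y) expRD.
  by apply: ler_wpM2l => //; exact: expR_ge0.
have p : 0 < 1 + y by lra.
rewrite -(ler_pM2r p).
have : 0 <= y ^+ 3 by rewrite exprn_ge0.
have -> : - (1 - y - expR (- y)) * (1 + y) = expR (- y) * (1 + y) - 1 + y ^+ 2 by ring.
have -> : y ^+ 2 * (1 + y) = y ^+ 2 + y ^+ 3 by ring.
lra.
Qed.

(** The cap 2 makes the bound usable for errors that are small only in probability: the right side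
    is twice a truncated error. *)
Lemma normr_cosB x y : `|cos (x + y) - cos x| <= Num.min 2 (2 * `|y|).
Proof.
rewrite le_min; apply/andP; split.
  by rewrite (le_trans (ler_normB _ _))//; have := cos_max (x + y); have := cos_max x; lra.
rewrite cosD (_ : _ - _ = - (cos x * (1 - cos y)) - sin x * sin y); last by ring.
rewrite (le_trans (ler_normB _ _))// normrN !normrM.
have h1 : `|sin x| * `|sin y| <= `|y|.
  by rewrite (le_trans _ (normr_sin_le y))// ler_piMl// sin_max.
have h2 : `|cos x| * `|1 - cos y| <= `|y|.
  rewrite (@le_trans _ _ `|1 - cos y|)//; first by rewrite ler_piMl// cos_max.
  rewrite one_sub_cos (ger0_norm (mulr_ge0 (ler0n _ 2) (sqr_ge0 _))).
  have := normr_sin_le (y / 2); have := sin_max (y / 2).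
  rewrite -[X in 2 * X <= _]real_normK ?num_real// normrM => h3 h4.
  have := ler_pM (normr_ge0 _) (normr_ge0 _) h3 h4; rewrite -expr2.
  by rewrite [ `|2^-1|]gtr0_norm ?invr_gt0//; lra.
lra.
Qed.

End trigonometric_bounds.

(** * Integrability and expectation of real random variables *)

Section expectation.
Context {R : realType} {d : measure_display} {T : measurableType d}.
Variable P : probability T R.
Implicit Types f g h : T -> R.

Notation intble f := (P.-integrable setT (EFin \o f)).

Lemma intble_meas f : intble f -> measurable_fun setT f.
Proof. by move=> /integrableP[/measurable_EFinP]. Qed.

Lemma intble_le f g : measurable_fun setT f -> intble g ->
  (forall t, `|f t| <= g t) -> intble f.
Proof.
move=> mf ig fg; apply: le_integrable ig => //; first exact/measurable_EFinP.
by move=> t _ /=; rewrite lee_fin (le_trans (fg t))// ler_norm.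
Qed.

Lemma intble_cst (c : R) : intble (fun=> c).
Proof. exact: (@finite_measure_integrable_cst _ _ _ P setT c). Qed.

Lemma intble_bounded f (B : R) : measurable_fun setT f ->
  (forall t, `|f t| <= B) -> intble f.
Proof. by move=> mf; apply: intble_le => //; exact: intble_cst. Qed.

Lemma intbleD f g : intble f -> intble g -> intble (fun t => f t + g t).
Proof. by move=> jf jg; have := integrableD measurableT jf jg. Qed.

Lemma intbleB f g : intble f -> intble g -> intble (fun t => f t - g t).
Proof. by move=> jf jg; have := integrableB measurableT jf jg. Qed.

Lemma intbleZ (c : R) f : intble f -> intble (fun t => c * f t).
Proof. by move=> jf; have := integrableZl measurableT c jf. Qed.

Lemma intble_sum (I : Type) (r : seq I) (Q : pred I) (F : I -> T -> R) :
  (forall i, Q i -> intble (F i)) -> intble (fun t => \sum_(i <- r | Q i) F i t).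
Proof.
move=> jF; elim: r => [|i r IH].
  by rewrite (_ : (fun t => _) = fun=> 0); [exact: intble_cst|
    apply/funext => t; rewrite big_nil].
case Qi : (Q i).
  rewrite (_ : (fun t => _) = fun t => F i t + \sum_(j <- r | Q j) F j t).
    by apply: intbleD => //; exact: jF.
  by apply/funext => t; rewrite big_cons Qi.
by rewrite (_ : (fun t => _) = fun t => \sum_(j <- r | Q j) F j t)//;
  apply/funext => t; rewrite big_cons Qi.
Qed.

Lemma intble_norm f : intble f -> intble (fun t => `|f t|).
Proof. exact: integrable_norm. Qed.

Lemma Ex_cst (c : R) : \int[P]_t c = c.
Proof. by rewrite Rintegral_cst// (_ : fine _ = 1) ?mulr1//; have := probability_setT P => /= ->. Qed.

Lemma Ex_sum (I : Type) (r : seq I) (Q : pred I) (F : I -> T -> R) :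
  (forall i, Q i -> intble (F i)) ->
  \int[P]_t (\sum_(i <- r | Q i) F i t) = \sum_(i <- r | Q i) \int[P]_t F i t.
Proof.
move=> jF; elim: r => [|i r IH].
  by rewrite big_nil; under eq_Rintegral do rewrite big_nil; exact: Ex_cst.
rewrite big_cons; case Qi : (Q i); under eq_Rintegral do rewrite big_cons Qi.
  by rewrite RintegralD ?IH//; [exact: jF|exact: intble_sum].
exact: IH.
Qed.

Lemma Ex_le f g : intble f -> intble g -> (forall t, f t <= g t) ->
  \int[P]_t f t <= \int[P]_t g t.
Proof. by move=> jf jg fg; apply: le_Rintegral. Qed.

Lemma normr_Ex_le f g : intble f -> intble g -> (forall t, `|f t| <= g t) ->
  `|\int[P]_t f t| <= \int[P]_t g t.
Proof.
move=> jf jg fg; apply: le_trans (le_normr_Rintegral _ _) _ => //.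
by apply: Ex_le => //; exact: intble_norm.
Qed.

Lemma Ex_EFin f : intble f -> (\int[P]_t (f t)%:E)%E = (\int[P]_t f t)%:E.
Proof. by move=> jf; rewrite fineK//; exact: integrable_fin_num. Qed.

Lemma Ex_dct (f_ : nat -> T -> R) f g :
  (forall n, measurable_fun setT (f_ n)) -> measurable_fun setT f -> intble g ->
  (forall t, f_ ^~ t @ \oo --> f t) -> (forall n t, `|f_ n t| <= g t) ->
  intble f /\ (fun n => \int[P]_t f_ n t) @ \oo --> \int[P]_t f t.
Proof.
move=> mf_ mf jg ff fg.
have [|||||jf _ cf] := @dominated_convergence _ _ _ P setT measurableT
  (fun n => EFin \o f_ n) (EFin \o f) (EFin \o g).
- by move=> n; exact/measurable_EFinP.
- exact/measurable_EFinP.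
- by apply: aeW => t _; apply: cvg_EFin; [exact: nearW|exact: ff].
- exact: jg.
- by apply: aeW => t n _; rewrite lee_fin.
split=> //; apply: fine_cvg; rewrite -Ex_EFin//.
Qed.

Lemma intble_of_finite f (M : R) : measurable_fun setT f -> (forall t, 0 <= f t) ->
  (\int[P]_t (f t)%:E <= M%:E)%E -> intble f /\ \int[P]_t f t <= M.
Proof.
move=> mf f0 fM; have jf : intble f.
  apply/integrableP; split; first exact/measurable_EFinP.
  apply: le_lt_trans (ltry M); apply: le_trans fM.
  rewrite le_eqVlt; apply/orP; left; apply/eqP; apply: eq_integral => t _ /=.
  by rewrite ger0_norm.
by split=> //; rewrite -lee_fin -Ex_EFin.
Qed.

End expectation.
Local Notation intble P f := (P.-integrable setT (EFin \o f)).

(** * Conditional expectation *)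

Section sub_sigma_algebra.
Context {R : realType} {d : measure_display} {T : measurableType d}.
Variable G : set (set T).
Hypothesis sG : sigma_algebra setT G.
Implicit Types f g : T -> R.

(** Viewing [G] as the measurable sets of a type transfers all closure properties of measurable
    functions to [Gmeasurable]. *)
Lemma GmeasurableP f :
  Gmeasurable G f <-> measurable_fun (setT : set (g_sigma_algebraType G)) f.
Proof.
split=> [Gf _ B mB|mf B mB].
  by rewrite setTI; apply: sub_sigma_algebra; exact: Gf.
have := mf measurableT B mB; rewrite setTI.
by rewrite measurable_g_measurableTypeE.
Qed.

Lemma Gmeasurable_cst (c : R) : Gmeasurable G (fun=> c).
Proof. by apply/GmeasurableP; exact: measurable_cst. Qed.

Lemma GmeasurableD f g : Gmeasurable G f -> Gmeasurable G g ->
  Gmeasurable G (fun t => f t + g t).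
Proof. by move=> /GmeasurableP mf /GmeasurableP mg; apply/GmeasurableP; exact: measurable_funD. Qed.

Lemma GmeasurableM f g : Gmeasurable G f -> Gmeasurable G g ->
  Gmeasurable G (fun t => f t * g t).
Proof. by move=> /GmeasurableP mf /GmeasurableP mg; apply/GmeasurableP; exact: measurable_funM. Qed.

Lemma Gmeasurable_comp (h : R -> R) f : measurable_fun setT h ->
  Gmeasurable G f -> Gmeasurable G (fun t => h (f t)).
Proof. by move=> mh /GmeasurableP mf; apply/GmeasurableP; exact: measurableT_comp. Qed.

Lemma Gmeasurable_sum (I : Type) (r : seq I) (F : I -> T -> R) :
  (forall i, Gmeasurable G (F i)) -> Gmeasurable G (fun t => \sum_(i <- r) F i t).
Proof.
move=> mF; elim: r => [|i r IH].
  by rewrite (_ : (fun t => _) = fun=> 0); [exact: Gmeasurable_cst|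
    apply/funext => t; rewrite big_nil].
rewrite (_ : (fun t => _) = fun t => F i t + \sum_(j <- r) F j t).
  exact: GmeasurableD.
by apply/funext => t; rewrite big_cons.
Qed.

Lemma Gmeasurable_dot (p : nat) (w : 'cV[R]_p) (X : T -> 'cV[R]_p) :
  Gmeasurable_vec G X -> Gmeasurable G (fun t => dot w (X t)).
Proof.
move=> mX; rewrite (_ : (fun t => _) = fun t => \sum_i w i ord0 * X t i ord0).
  by apply: Gmeasurable_sum => i; apply: GmeasurableM => //; exact: Gmeasurable_cst.
by apply/funext => t; rewrite dotE.
Qed.

Lemma Gmeasurable_mfun f : G `<=` measurable -> Gmeasurable G f ->
  measurable_fun setT f.
Proof. by move=> sub Gf _ B mB; rewrite setTI; apply: sub; exact: Gf. Qed.

End sub_sigma_algebra.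

Lemma Gmeasurable_sub {R : realType} {d : measure_display} {T : measurableType d}
    (G H : set (set T)) (f : T -> R) :
  G `<=` H -> Gmeasurable G f -> Gmeasurable H f.
Proof. by move=> GH Gf B mB; apply: GH; exact: Gf. Qed.

(** * Rounding to a finite grid *)

Section discretization.
Context {R : realType}.
Implicit Types z : R.

Definition cell (n i : nat) : set R :=
  [set z | i%:R <= n.+1%:R * (z + n.+1%:R) < i.+1%:R].

(** Rounds [z] down to the grid of mesh [1 / n.+1] on [[- n.+1, n.+1[], which has [2 * n.+1 * n.+1]
    cells, and returns 0 elsewhere. Being a finite combination of indicators, it fits the set-wise
    definition of conditional expectation. *)
Definition discr (n : nat) z : R :=
  \sum_(i < 2 * n.+1 * n.+1) (i%:R / n.+1%:R - n.+1%:R) * \1_(cell n i) z.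

Lemma measurable_cell n i : measurable (cell n i).
Proof.
have n0 : 0 < n.+1%:R :> R by rewrite ltr0n.
rewrite (_ : cell n i =
  `[i%:R / n.+1%:R - n.+1%:R, i.+1%:R / n.+1%:R - n.+1%:R[%classic).
  exact: measurable_itv.
apply/seteqP; split=> z /=; rewrite in_itv/= lerBlDr ltrBrDr.
  by rewrite ler_pdivrMr// ltr_pdivlMr// mulrC.
by rewrite ler_pdivrMr// ltr_pdivlMr// mulrC.
Qed.

Lemma measurable_discr n : measurable_fun setT (discr n).
Proof.
apply: measurable_sum => i; apply: measurable_funM => //.
by apply: measurable_indic; exact: measurable_cell.
Qed.

Lemma discr_out n z : ~~ (- n.+1%:R <= z < n.+1%:R) -> discr n z = 0.
Proof.
move=> zn; rewrite /discr big1// => i _; rewrite indicE memNset ?mulr0//= => /andP[h1 h2].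
have n0 : 0 < n.+1%:R :> R by rewrite ltr0n.
move: zn; rewrite negb_and -!ltNge -leNgt => /orP[h|h].
  have : n.+1%:R * (z + n.+1%:R) < 0 by rewrite pmulr_rlt0//; lra.
  by have := ler0n R i; lra.
have : i.+1%:R <= n.+1%:R * (2 * n.+1%:R) :> R.
  by rewrite -!natrM ler_nat; have := ltn_ord i; nia.
have : n.+1%:R * (2 * n.+1%:R) <= n.+1%:R * (z + n.+1%:R) :> R by rewrite ler_pM2l//; lra.
by lra.
Qed.

Lemma discr_in n z : - n.+1%:R <= z < n.+1%:R ->
  discr n z <= z <= discr n z + n.+1%:R^-1.
Proof.
move=> /andP[z1 z2]; have n0 : 0 < n.+1%:R :> R by rewrite ltr0n.
set y := n.+1%:R * (z + n.+1%:R).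
have y0 : 0 <= y by rewrite /y mulr_ge0//; lra.
have yt : (Num.truncn y)%:R <= y < (Num.truncn y).+1%:R by exact: truncn_itv.
set k := Num.truncn y in yt.
have kN : (k < 2 * n.+1 * n.+1)%N.
  rewrite -(ltr_nat R) (le_lt_trans (andP yt).1)// !natrM /y mulrC.
  by rewrite ltr_pM2r//; lra.
have -> : discr n z = k%:R / n.+1%:R - n.+1%:R.
  rewrite /discr (bigD1 (Ordinal kN))//= indicE mem_set ?mulr1//.
  rewrite big1 ?addr0// => i ik; rewrite indicE memNset ?mulr0// => /= /andP[h1 h2].
  case/eqP: ik; apply/val_inj => /=; case/andP: yt => h3 h4.
  have : i%:R < k.+1%:R :> R by apply: le_lt_trans h4.
  have : k%:R < i.+1%:R :> R by apply: le_lt_trans h2.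
  by rewrite !ltr_nat; lia.
move: yt; rewrite /y -(natr1 k) => /andP[h1 h2].
rewrite lerBlDr ler_pdivrMr// mulrC h1/=.
have -> : k%:R / n.+1%:R - n.+1%:R + n.+1%:R^-1 = (k%:R + 1) / n.+1%:R - n.+1%:R :> R.
  by field; rewrite gt_eqF.
by rewrite lerBrDr ler_pdivlMr// mulrC ltW.
Qed.

Lemma discr_le n z : `|discr n z| <= `|z| + 1.
Proof.
have [h|/discr_out->] := boolP (- n.+1%:R <= z < n.+1%:R); last first.
  by rewrite normr0 addr_ge0.
have /andP[h1 h2] := discr_in h.
have : n.+1%:R^-1 <= 1 :> R by rewrite invf_le1 ?ltr0n// ler1n.
move: h2; move: (n.+1%:R^-1) => c h2.
have := ler_norm z; have := ler_norm (- z); rewrite normrN => h3 h4 h5.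
by rewrite ler_norml; apply/andP; split; lra.
Qed.

Lemma discr_cvg z : discr ^~ z @ \oo --> z.
Proof.
apply/cvgrPdist_le => e e0.
pose N := (Num.truncn `|z|).+1.
have [M HM] := eventually_le (@cvg_invn0 R) e0.
exists (maxn N M) => // n /=; rewrite geq_max => /andP[Nn Mn].
have zN : `|z| < N%:R by exact: truncnS_gt.
have Nn1 : N%:R <= n.+1%:R :> R by rewrite ler_nat leqW.
have : - n.+1%:R <= z < n.+1%:R.
  by have := ler_norm z; have := ler_norm (- z); rewrite normrN => h1 h2; apply/andP; split; lra.
move=> /discr_in /andP[h1 h2].
have := HM n.+1 (leqW Mn); rewrite ger0_norm ?invr_ge0//.
move: h2; move: (n.+1%:R^-1) => c h2 h3.
by rewrite ger0_norm ?subr_ge0//; lra.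
Qed.

End discretization.

Section conditional_expectation.
Context {R : realType} {d : measure_display} {T : measurableType d}.
Variables (P : probability T R) (G : set (set T)).
Hypotheses (sG : sigma_algebra setT G) (GT : G `<=` measurable).
Implicit Types X Y Z : T -> R.

(** The definition gives the identity for indicators of sets in [G], hence for [discr n (Z t)],
    whose level sets are preimages of cells. Dominated convergence with dominating function
    [|Z W| + |W|] then reaches [Z], for [W = X] and [W = Y]. *)
Lemma cond_exp_mul X Y Z : is_cond_exp P G X Y -> Gmeasurable G Z ->
  intble P (fun t => Z t * X t) -> intble P (fun t => Z t * Y t) ->
  \int[P]_t (Z t * X t) = \int[P]_t (Z t * Y t).
Proof.
move=> [jX [GY [jY XY]]] GZ jZX jZY.
have mZ := Gmeasurable_mfun GT GZ.
have mX := intble_meas jX; have mY := intble_meas jY.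
have mdisc n : measurable_fun setT (fun t => discr n (Z t)).
  exact: measurableT_comp (measurable_discr n) mZ.
have jdisc W n : intble P W -> intble P (fun t => discr n (Z t) * W t).
  move=> jW; pose B : R := \sum_(i < 2 * n.+1 * n.+1) `|i%:R / n.+1%:R - n.+1%:R|.
  apply: (intble_le (g := fun t => B * `|W t|)).
  - by apply: measurable_funM => //; exact: intble_meas jW.
  - by apply: intbleZ; exact: intble_norm.
  - move=> t; rewrite normrM; apply: ler_wpM2r => //.
    apply: le_trans (ler_norm_sum _ _ _) _; apply: ler_sum => i _.
    by rewrite normrM ler_piMr// indicE; case: (_ \in _); rewrite ?normr1 ?normr0.
have lim W : intble P W -> intble P (fun t => Z t * W t) ->
    (fun n => \int[P]_t (discr n (Z t) * W t)) @ \oo --> \int[P]_t (Z t * W t).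
  move=> jW jZW.
  have [] // := @Ex_dct R d T P (fun n t => discr n (Z t) * W t) (fun t => Z t * W t)
    (fun t => `|Z t * W t| + `|W t|).
  - by move=> n; exact: intble_meas (jdisc _ _ jW).
  - exact: intble_meas jZW.
  - by apply: intbleD; exact: intble_norm.
  - by move=> t; apply: cvgMr_tmp; exact: discr_cvg.
  - move=> n t; rewrite !normrM -[X in _ <= _ + X]mul1r -mulrDl.
    by apply: ler_wpM2r => //; exact: discr_le.
have simple n : \int[P]_t (discr n (Z t) * X t) = \int[P]_t (discr n (Z t) * Y t).
  have exp W : intble P W -> \int[P]_t (discr n (Z t) * W t) =
     \sum_(i < 2 * n.+1 * n.+1) (i%:R / n.+1%:R - n.+1%:R) *
       \int[P]_(t in Z @^-1` cell n i) W t.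
    move=> jW; under eq_Rintegral do rewrite mulr_suml.
    have jI (i : nat) : intble P (fun t => \1_(cell n i) (Z t) * W t).
      apply: (intble_le (g := fun t => `|W t|)); last 2 first.
      - exact: intble_norm.
      - move=> t; rewrite normrM ler_piMl// indicE.
        by case: (_ \in _); rewrite ?normr1 ?normr0.
      apply: measurable_funM; last exact: intble_meas jW.
      have mI : measurable_fun setT (\1_(cell n i) : R -> R).
        by apply: measurable_indic; exact: measurable_cell.
      exact: measurableT_comp mI mZ.
    rewrite Ex_sum => [|i _]; last first.
      under eq_fun do rewrite -mulrA.
      exact: intbleZ.
    apply: eq_bigr => i _; under eq_Rintegral do rewrite -mulrA.
    rewrite RintegralZl//; congr (_ * _).
    rewrite [RHS]Rintegral_mkcond; apply: eq_Rintegral => t _.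
    rewrite /restrict /patch indicE.
    have -> : (t \in Z @^-1` cell n i) = (Z t \in cell n i) by apply/idP/idP => /set_mem h; exact/mem_set.
    by case: (_ \in _); rewrite ?mul1r ?mul0r.
  rewrite !exp//; apply: eq_bigr => i _; congr (_ * _).
  by rewrite /Rintegral XY//; apply: GZ; exact: measurable_cell.
have := lim X jX jZX; under eq_fun do rewrite simple.
move=> h; exact: (cvg_unique _ h (lim Y jY jZY)).
Qed.

Lemma cond_exp_Ex X Y : is_cond_exp P G X Y -> \int[P]_t X t = \int[P]_t Y t.
Proof.
move=> [_ [_ [_ XY]]]; rewrite /Rintegral XY//.
by have [_ _ _] := sG; have [G0 GC _] := sG; rewrite -[setT]setD0; exact: GC.
Qed.

Lemma cond_exp_le_Ex X (c : R) : cond_exp_le P G X c ->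
  intble P X /\ \int[P]_t X t <= c.
Proof.
move=> [Y [XY Yc]]; rewrite (cond_exp_Ex XY).
have [jX [_ [jY _]]] := XY; split => //.
have mY := intble_meas jY.
(* [Y <= c] holds only almost everywhere; cutting [Y] at [c] alters it on a null set and makes the
   comparison pointwise. *)
have jm : intble P (fun t => Num.min (Y t) c).
  apply: (intble_le (g := fun t => `|Y t| + `|c|)).
  - by apply: measurable_minr.
  - by apply: intbleD; [exact: intble_norm|exact: intble_cst].
  - by move=> t; rewrite minEle; case: ifP => _; rewrite ?lerDl ?lerDr.
have -> : \int[P]_t Y t = \int[P]_t Num.min (Y t) c.
  rewrite /Rintegral; congr fine; apply: ae_eq_integral => //.
  - exact/measurable_EFinP.
  - by apply/measurable_EFinP; exact: intble_meas jm.
  - by apply: filterS Yc => t Yt _; rewrite min_l.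
rewrite -[leRHS](Ex_cst P); apply: Ex_le => //; first exact: intble_cst.
by move=> t; rewrite ge_min lexx orbT.
Qed.

End conditional_expectation.

(** * A martingale central limit theorem *)

Lemma measurable_cos (R : realType) : measurable_fun setT (@cos R).
Proof. by apply: continuous_measurable_fun; exact: continuous_cos. Qed.

Lemma measurable_sin (R : realType) : measurable_fun setT (@sin R).
Proof. by apply: continuous_measurable_fun; exact: continuous_sin. Qed.

(** * Linearity of conditional expectation *)

Section conditional_expectation_linear.
Context {R : realType} {d : measure_display} {T : measurableType d}.
Variables (P : probability T R) (G : set (set T)).
Hypotheses (sG : sigma_algebra setT G) (GT : G `<=` measurable).
Implicit Types X Y Z : T -> R.

Lemma cond_expD X1 X2 Y1 Y2 : is_cond_exp P G X1 Y1 -> is_cond_exp P G X2 Y2 ->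
  is_cond_exp P G (fun t => X1 t + X2 t) (fun t => Y1 t + Y2 t).
Proof.
move=> [jX1 [GY1 [jY1 E1]]] [jX2 [GY2 [jY2 E2]]].
split; [exact: intbleD|split; [exact: GmeasurableD|split; [exact: intbleD|]]].
move=> B GB; have mB := GT GB.
rewrite !integralD_EFin//; first by rewrite E1// E2.
all: by apply: (@integrableS _ _ _ P setT).
Qed.

Lemma cond_expZ (c : R) X Y : is_cond_exp P G X Y ->
  is_cond_exp P G (fun t => c * X t) (fun t => c * Y t).
Proof.
move=> [jX [GY [jY E1]]].
split; [exact: intbleZ|split; [|split; [exact: intbleZ|]]].
  by apply: GmeasurableM => //; exact: Gmeasurable_cst.
move=> B GB; have mB := GT GB.
under eq_integral do rewrite EFinM.
under [RHS]eq_integral do rewrite EFinM.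
rewrite !integralZl//; first by rewrite E1.
all: by apply: (@integrableS _ _ _ P setT).
Qed.

Lemma cond_exp_sum (I : Type) (r : seq I) (X Y : I -> T -> R) :
  (forall i, is_cond_exp P G (X i) (Y i)) ->
  is_cond_exp P G (fun t => \sum_(i <- r) X i t) (fun t => \sum_(i <- r) Y i t).
Proof.
move=> XY; elim: r => [|i r IH].
  rewrite (_ : (fun t => \sum_(i <- [::]) X i t) = fun=> 0); last first.
    by apply/funext => t; rewrite big_nil.
  rewrite (_ : (fun t => \sum_(i <- [::]) Y i t) = fun=> 0); last first.
    by apply/funext => t; rewrite big_nil.
  split; first exact: intble_cst.
  by split; [exact: Gmeasurable_cst|split; [exact: intble_cst|]].
have E (W : I -> T -> R) : (fun t => \sum_(j <- i :: r) W j t) =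
    fun t => W i t + \sum_(j <- r) W j t.
  by apply/funext => t; rewrite big_cons.
by rewrite !E; exact: cond_expD.
Qed.

Lemma cond_exp_dot0 (p : nat) (w : 'cV[R]_p) (X : T -> 'cV[R]_p) :
  (forall i, is_cond_exp P G (fun t => X t i ord0) (fun=> 0)) ->
  is_cond_exp P G (fun t => dot w (X t)) (fun=> 0).
Proof.
move=> h; have := cond_exp_sum (index_enum 'I_p)
  (fun i => cond_expZ (w i ord0) (h i)).
congr is_cond_exp; apply/funext => t; first by rewrite dotE.
by rewrite big1// => i _; rewrite mulr0.
Qed.

Lemma cond_exp_quadratic (p : nat) (w : 'cV[R]_p) (X : T -> 'cV[R]_p)
    (V : T -> 'M[R]_p) :
  (forall i j, is_cond_exp P G (fun t => (X t *m (X t)^T) i j) (fun t => V t i j)) ->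
  is_cond_exp P G (fun t => dot w (X t) ^+ 2) (fun t => dot w (V t *m w)).
Proof.
move=> h; have := cond_exp_sum (index_enum 'I_p) (fun i =>
  cond_exp_sum (index_enum 'I_p) (fun j =>
    cond_expZ (w i ord0 * w j ord0) (h i j))).
congr is_cond_exp; apply/funext => t.
  rewrite dotE expr2 mulr_suml; apply: eq_bigr => i _.
  rewrite mulr_sumr; apply: eq_bigr => j _; rewrite mxE big_ord1 mxE.
  by ring.
rewrite dotE; apply: eq_bigr => i _; rewrite mxE mulr_sumr; apply: eq_bigr => j _.
by ring.
Qed.

End conditional_expectation_linear.

Section moments.
Context {R : realType} {d : measure_display} {T : measurableType d}.
Variable P : probability T R.
Implicit Types X Y : T -> R.

Lemma le1D_expr4 (y : R) : `|y| ^+ 3 <= 1 + y ^+ 4 /\ y ^+ 2 <= 1 + y ^+ 4.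
Proof.
have -> : y ^+ 4 = `|y| ^+ 4 by rewrite -normrX ger0_norm// exprn_even_ge0.
have -> : y ^+ 2 = `|y| ^+ 2 by rewrite -normrX ger0_norm// sqr_ge0.
move: `|y| (normr_ge0 y) => {}y y0.
have [y1|/ltW y1] := leP y 1.
  by split; rewrite ler_wpDr ?exprn_ge0// exprn_ile1.
by split; rewrite ler_wpDl// ler_weXn2l.
Qed.

Lemma intble_sqr4 X : measurable_fun setT X -> intble P (fun t => X t ^+ 4) ->
  intble P (fun t => X t ^+ 2).
Proof.
move=> mX j4; apply: (intble_le (g := fun t => 1 + X t ^+ 4)).
- exact: measurable_funX.
- by apply: intbleD => //; exact: intble_cst.
- by move=> t; rewrite ger0_norm ?sqr_ge0// (le1D_expr4 _).2.
Qed.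

Lemma intbleM_bdd X Y (B : R) : measurable_fun setT Y -> intble P X ->
  (forall t, `|Y t| <= B) -> intble P (fun t => Y t * X t).
Proof.
move=> mY jX YB; apply: (intble_le (g := fun t => B * `|X t|)).
- by apply: measurable_funM => //; exact: intble_meas jX.
- by apply: intbleZ; exact: intble_norm.
- by move=> t; rewrite normrM ler_wpM2r.
Qed.

Lemma intbleM_sqr X Y : measurable_fun setT X -> measurable_fun setT Y ->
  intble P (fun t => X t ^+ 2) -> intble P (fun t => Y t ^+ 2) ->
  intble P (fun t => X t * Y t).
Proof.
move=> mX mY jX jY; apply: (intble_le (g := fun t => X t ^+ 2 + Y t ^+ 2)).
- exact: measurable_funM.
- exact: intbleD.
- move=> t; rewrite ler_norml; have := sqr_ge0 (X t + Y t); have := sqr_ge0 (X t - Y t).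
  rewrite sqrrB sqrrD => h1 h2; have := sqr_ge0 (X t); have := sqr_ge0 (Y t).
  by move=> h3 h4; apply/andP; split; lra.
Qed.

(** Pointwise, [|x| <= c + x^2 / c] with [c = e / 2]; it then suffices that the mean square is at
    most [c^2]. *)
Lemma sqr_cvg0_norm_cvg0 (X : nat -> T -> R) :
  (forall n, measurable_fun setT (X n)) ->
  (forall n, intble P (fun t => X n t ^+ 2)) ->
  (fun n => \int[P]_t (X n t ^+ 2)) @ \oo --> 0 ->
  (fun n => \int[P]_t `|X n t|) @ \oo --> 0.
Proof.
move=> mX jX X0; apply/cvgr0Pnorm_le => e e0.
have e2 : 0 < e / 2 by rewrite divr_gt0.
have ee : 0 < e / 2 * (e / 2) by rewrite mulr_gt0.
have [N HN] := eventually_le X0 ee; exists N => // n /= Nn.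
rewrite ger0_norm; last by apply: Rintegral_ge0.
have jb : intble P (fun t => e / 2 + (e / 2)^-1 * X n t ^+ 2).
  by apply: intbleD; [exact: intble_cst|exact: intbleZ].
have bnd t : `|X n t| <= e / 2 + (e / 2)^-1 * X n t ^+ 2.
  rewrite -(ler_pM2l e2) mulrDr mulVKf ?gt_eqF//.
  rewrite -[X n t ^+ 2]real_normK ?num_real//; move: `|X n t| => y.
  by have := sqr_ge0 (e / 2 - y); have := sqr_ge0 (e / 2); have := sqr_ge0 y;
    rewrite sqrrB -expr2; lra.
apply: le_trans (Ex_le _ jb bnd) _.
  by apply: (intble_le _ jb) => [|t]; [exact: measurableT_comp|rewrite normr_id].
rewrite RintegralD//; [|exact: intble_cst|exact: intbleZ].
rewrite Ex_cst RintegralZl// [leRHS]splitr lerD2l ler_pdivrMl//.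
by have := HN n Nn; rewrite ger0_norm// Rintegral_ge0// => t _; exact: sqr_ge0.
Qed.

End moments.

Section martingale.
Context {R : realType} {d : measure_display} {T : measurableType d}.
Variables (P : probability T R) (F : nat -> set (set T)).
Hypothesis fF : filtration F.

Let sF n : sigma_algebra setT (F n). Proof. by case: fF. Qed.
Let FT n : F n `<=` measurable. Proof. by case: fF => _ []. Qed.
Let Fmono n m : (n <= m)%N -> F n `<=` F m. Proof. case: fF => _ [_ h]; exact: h. Qed.

Lemma adapted_sum (X : nat -> T -> R) n :
  (forall k, (0 < k)%N -> Gmeasurable (F k) (X k)) ->
  Gmeasurable (F n) (fun t => \sum_(1 <= j < n.+1) X j t).
Proof.
move=> aX; elim: n => [|n IH].
  rewrite (_ : (fun t => _) = fun=> 0); first exact: Gmeasurable_cst.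
  by apply/funext => t; rewrite big_geq.
rewrite (_ : (fun t => _) = fun t => \sum_(1 <= j < n.+1) X j t + X n.+1 t).
  apply: GmeasurableD => //; last exact: aX.
  by apply: Gmeasurable_sub IH; apply: Fmono.
by apply/funext => t; rewrite big_nat_recr.
Qed.

(** The sum up to [n] is [F n]-measurable, so [cond_exp_mul] replaces the next increment by 0 in the
    cross term. *)
Lemma orthogonal_sum (X : nat -> T -> R) n :
  (forall k, (0 < k)%N -> Gmeasurable (F k) (X k)) ->
  (forall k, (0 < k)%N -> is_cond_exp P (F k.-1) (X k) (fun=> 0)) ->
  (forall k, (0 < k)%N -> intble P (fun t => X k t ^+ 2)) ->
  intble P (fun t => (\sum_(1 <= j < n.+1) X j t) ^+ 2) /\
  \int[P]_t ((\sum_(1 <= j < n.+1) X j t) ^+ 2) =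
    \sum_(1 <= j < n.+1) \int[P]_t (X j t ^+ 2).
Proof.
move=> aX cX jX; elim: n => [|n [jS ES]].
  rewrite (_ : (fun t => _) = fun=> 0); last first.
    by apply/funext => t; rewrite big_geq// expr0n.
  by split; [exact: intble_cst|rewrite big_geq// Ex_cst].
pose S t := \sum_(1 <= j < n.+1) X j t.
have GS : Gmeasurable (F n) S by exact: adapted_sum.
have mS : measurable_fun setT S by exact: Gmeasurable_mfun GS.
have mX : measurable_fun setT (X n.+1) by exact: Gmeasurable_mfun (aX n.+1 isT).
have jSX : intble P (fun t => S t * X n.+1 t) by apply: intbleM_sqr => //; exact: jX.
rewrite (_ : (fun t => _) = fun t => (S t ^+ 2 + 2 * (S t * X n.+1 t)) + X n.+1 t ^+ 2);
  last by apply/funext => t; rewrite big_nat_recr//= -/(S t); ring.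
have j1 : intble P (fun t => S t ^+ 2 + 2 * (S t * X n.+1 t)).
  by apply: intbleD => //; exact: intbleZ.
split; first by apply: intbleD => //; exact: jX.
rewrite RintegralD//; last exact: jX.
rewrite RintegralD//; last exact: intbleZ.
rewrite RintegralZl// ES (cond_exp_mul (FT (n := n)) (cX n.+1 isT) GS)//; last first.
  rewrite (_ : (fun t => _) = fun=> 0); first exact: intble_cst.
  by apply/funext => t; rewrite mulr0.
have -> : \int[P]_t (S t * 0) = 0.
  by under eq_Rintegral do rewrite mulr0; exact: Ex_cst.
by rewrite mulr0 addr0 [RHS]big_nat_recr.
Qed.

Section clt.
Variables (eta : nat -> T -> R) (b : nat -> R) (s2 C : R).
Hypothesis s20 : 0 <= s2.
Hypothesis eta_ad : forall k, (0 < k)%N -> Gmeasurable (F k) (eta k).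
Hypothesis eta_mds : forall k, (0 < k)%N -> is_cond_exp P (F k.-1) (eta k) (fun=> 0).
Hypothesis eta4 : forall k, (0 < k)%N -> intble P (fun t => eta k t ^+ 4).
Hypothesis eta4C : forall k, (0 < k)%N -> \int[P]_t (eta k t ^+ 4) <= C.
Hypothesis b0 : b @ \oo --> 0.
Hypothesis eta_var : forall k Z, (0 < k)%N -> Gmeasurable (F k.-1) Z ->
  (forall t, `|Z t| <= 1) -> `|\int[P]_t (Z t * (eta k t ^+ 2 - s2))| <= b k.

Let meta k : (0 < k)%N -> measurable_fun setT (eta k).
Proof. by move=> k0; apply: Gmeasurable_mfun (eta_ad k0); exact: FT. Qed.

Let C0 : 0 <= C.
Proof.
by apply: le_trans (eta4C (k := 1) isT); apply: Rintegral_ge0 => t _; exact: exprn_even_ge0.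
Qed.

(** Expand [cos (S + q eta)] to second order in [q eta]. The linear term vanishes because [sin S] is
    [F k.-1]-measurable; in the quadratic one, [eta_var] with [Z = cos S] replaces [eta^2] by [s2]
    at cost [q^2 / 2 * b k]. Replacing [1 - q^2 s2 / 2] by the exponential costs [q^4 s2^2], and
    [q <= 1] lets the Taylor remainder be of order [q^3]. *)
Lemma clt_step k (q : R) (S : T -> R) : (0 < k)%N -> 0 <= q <= 1 ->
  Gmeasurable (F k.-1) S ->
  `|\int[P]_t cos (S t + q * eta k t) - expR (- (q ^+ 2 * s2 / 2)) * \int[P]_t cos (S t)|
  <= q ^+ 2 / 2 * b k + q ^+ 4 * s2 ^+ 2 + 2 * q ^+ 3 * (1 + C).
Proof.
move=> k0 /andP[q0 q1] GS; have mS := Gmeasurable_mfun (FT (n := _)) GS.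
have me := meta k0.
have mc : measurable_fun setT (fun t => cos (S t)).
  exact: measurableT_comp (@measurable_cos R) mS.
have ms : measurable_fun setT (fun t => sin (S t)).
  exact: measurableT_comp (@measurable_sin R) mS.
have jc : intble P (fun t => cos (S t)).
  by apply: (intble_bounded P (B := 1)) => // t; exact: cos_max.
have je : intble P (eta k) by case: (eta_mds k0).
have je2 : intble P (fun t => eta k t ^+ 2) by apply: intble_sqr4 => //; exact: eta4.
have jse : intble P (fun t => sin (S t) * eta k t).
  by apply: (intbleM_bdd (B := 1)) => // t; exact: sin_max.
have jv : intble P (fun t => cos (S t) * (eta k t ^+ 2 - s2)).
  apply: (intbleM_bdd (B := 1)) => //; last by move=> t; exact: cos_max.
  by apply: intbleB => //; exact: intble_cst.
pose y := q ^+ 2 * s2 / 2.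
pose r t := cos (S t + q * eta k t) - cos (S t) + q ^+ 2 / 2 * (cos (S t) * eta k t ^+ 2)
  + q * (sin (S t) * eta k t).
have msum : measurable_fun setT (fun t => S t + q * eta k t).
  by apply: measurable_funD => //; exact: measurable_funM.
have mcs : measurable_fun setT (fun t => cos (S t + q * eta k t)).
  exact: measurableT_comp (@measurable_cos R) msum.
have jcs : intble P (fun t => cos (S t + q * eta k t)).
  by apply: (intble_bounded P (B := 1)) => // t; exact: cos_max.
have rb t : `|r t| <= 2 * q ^+ 3 * (1 + eta k t ^+ 4).
  have [h1 _] := le1D_expr4 (eta k t).
  pose x := q * eta k t.
  have -> : r t = cos (S t) * (cos x - 1 + x ^+ 2 / 2) - sin (S t) * (sin x - x).
    by rewrite /r -/x cosD; move: (cos x) (sin x) => c s; rewrite /x; field.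
  rewrite (le_trans (ler_normB _ _))// !normrM.
  have q30 : 0 <= q ^+ 3 by exact: exprn_ge0.
  have a1 : `|cos (S t)| * `|cos x - 1 + x ^+ 2 / 2| <= q ^+ 3 * (1 + eta k t ^+ 4).
    apply: le_trans (_ : `|cos x - 1 + x ^+ 2 / 2| <= _).
      by rewrite ler_piMl// cos_max.
    apply: le_trans (normr_cos_sub _) _; rewrite /x exprMn.
    have h2 : 0 <= eta k t ^+ 4 by exact: exprn_even_ge0.
    have h3 : q ^+ 4 * eta k t ^+ 4 <= q ^+ 3 * eta k t ^+ 4.
      by apply: ler_wpM2r => //; rewrite exprSr ler_piMr.
    by have := mulr_ge0 q30 h2; lra.
  have a2 : `|sin (S t)| * `|sin x - x| <= q ^+ 3 * (1 + eta k t ^+ 4).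
    apply: le_trans (_ : `|sin x - x| <= _).
      by rewrite ler_piMl// sin_max.
    apply: le_trans (normr_sin_sub _) _; rewrite /x normrM exprMn (ger0_norm q0).
    exact: ler_wpM2l.
  by lra.
have jb : intble P (fun t => 2 * q ^+ 3 * (1 + eta k t ^+ 4)).
  by apply: intbleZ; apply: intbleD; [exact: intble_cst|exact: eta4].
have jr : intble P r.
  apply: (intble_le _ jb) => //.
  apply: measurable_funD; last first.
    by apply: measurable_funM => //; exact: measurable_funM.
  apply: measurable_funD; first exact: measurable_funB.
  by apply: measurable_funM => //; apply: measurable_funM => //; exact: measurable_funX.
have Er : `|\int[P]_t r t| <= 2 * q ^+ 3 * (1 + C).
  apply: le_trans (normr_Ex_le jr jb rb) _.
  rewrite RintegralZl//; last by apply: intbleD; [exact: intble_cst|exact: eta4].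
  apply: ler_wpM2l; first by rewrite mulr_ge0// exprn_ge0.
  rewrite RintegralD//; [|exact: intble_cst|exact: eta4].
  by rewrite Ex_cst lerD2l; exact: eta4C.
have Es : \int[P]_t (sin (S t) * eta k t) = 0.
  have Gs := Gmeasurable_comp (sF _) (@measurable_sin R) GS.
  have j0 : intble P (fun t => sin (S t) * 0).
    rewrite (_ : (fun t => _) = fun=> 0); first exact: intble_cst.
    by apply/funext => t; rewrite mulr0.
  rewrite (cond_exp_mul (FT (n := _)) (eta_mds k0) Gs jse j0).
  by under eq_Rintegral do rewrite mulr0; exact: Ex_cst.
have -> : \int[P]_t cos (S t + q * eta k t) =
    \int[P]_t r t - q ^+ 2 / 2 * \int[P]_t (cos (S t) * (eta k t ^+ 2 - s2))
    - q * \int[P]_t (sin (S t) * eta k t) + (1 - y) * \int[P]_t cos (S t).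
  have ja := intbleZ (q ^+ 2 / 2) jv; have jd := intbleZ q jse.
  have jg := intbleZ (1 - y) jc.
  have j1 := intbleB jr ja; have j2 := intbleB j1 jd.
  transitivity (\int[P]_t (r t - q ^+ 2 / 2 * (cos (S t) * (eta k t ^+ 2 - s2))
      - q * (sin (S t) * eta k t) + (1 - y) * cos (S t))).
    by apply: eq_Rintegral => t _; rewrite /r /y; field.
  by rewrite RintegralD// RintegralB// RintegralB// !RintegralZl.
have := eta_var k0 (Gmeasurable_comp (sF _) (@measurable_cos R) GS) (fun t => cos_max _).
rewrite Es mulr0 subr0 -/y.
set V := \int[P]_t (cos (S t) * _) => Vb.
have y0 : 0 <= y by rewrite /y !mulr_ge0// ?sqr_ge0// invr_ge0.
have Ec : `|\int[P]_t cos (S t)| <= 1.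
  rewrite -[leRHS](Ex_cst P); apply: normr_Ex_le => //; first exact: intble_cst.
  by move=> t; exact: cos_max.
rewrite (_ : _ - _ = \int[P]_t r t - q ^+ 2 / 2 * V +
  (1 - y - expR (- y)) * \int[P]_t cos (S t)); last by ring.
have n1 : `|(1 - y - expR (- y)) * \int[P]_t cos (S t)| <= q ^+ 4 * s2 ^+ 2.
  rewrite normrM; apply: le_trans (ler_piMr (normr_ge0 _) Ec) _.
  apply: le_trans (normr_expRN_sub y0) _.
  rewrite (_ : y ^+ 2 = q ^+ 4 * s2 ^+ 2 / 4); last by rewrite /y; field.
  have : 0 <= q ^+ 4 * s2 ^+ 2 by rewrite mulr_ge0 ?sqr_ge0// exprn_ge0.
  by lra.
have n2 : `|q ^+ 2 / 2 * V| <= q ^+ 2 / 2 * b k.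
  have q2 : 0 <= q ^+ 2 / 2 by rewrite divr_ge0 ?sqr_ge0.
  by rewrite normrM (ger0_norm q2); apply: ler_wpM2l.
apply: le_trans (ler_normD _ _) _.
by have := ler_normB (\int[P]_t r t) (q ^+ 2 / 2 * V); lra.
Qed.

Lemma martingale_clt (th : R) :
  (fun n => \int[P]_t cos ((Num.sqrt n%:R)^-1 * (\sum_(1 <= j < n.+1) eta j t) + th))
  @ \oo --> expR (- s2 / 2) * cos th.
Proof.
apply/subr_cvg0.
pose bd n : R := 2^-1 * (n%:R^-1 * \sum_(0 <= j < n) b j.+1) + n%:R^-1 * s2 ^+ 2
  + (Num.sqrt n%:R)^-1 * (2 * (1 + C)).
apply: (@cvg0_le _ _ bd 1); last first.
  apply: cvg0D; first apply: cvg0D.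
  - by apply: cvg0Ml; apply: cesaro0; move: b0; rewrite -cvg_shiftS.
  - by apply: cvg0Mr; exact: cvg_invn0.
  - by apply: cvg0Mr; exact: cvg_inv_sqrtn0.
move=> n n1; set q := (Num.sqrt n%:R)^-1.
have n0 : 0 < n%:R :> R by rewrite ltr0n.
have q2 : q ^+ 2 = n%:R^-1 by rewrite /q exprVn sqr_sqrtr// ltW.
have q0 : 0 <= q by rewrite invr_ge0 sqrtr_ge0.
have q1 : q <= 1.
  rewrite /q invf_le1 ?sqrtr_gt0// -[leLHS]sqrtr1 ler_sqrt ?ler1n//.
pose ee := expR (- (q ^+ 2 * s2 / 2)).
have ee1 : ee <= 1.
  by rewrite /ee -[leRHS]expR0 ler_expR oppr_le0 !mulr_ge0 ?sqr_ge0// invr_ge0.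
pose st k := q ^+ 2 / 2 * b k + q ^+ 4 * s2 ^+ 2 + 2 * q ^+ 3 * (1 + C).
(* [q] is fixed by [n] while the number [m] of increments grows. The phase [th] serves as starting
   value, and since [ee <= 1] the errors of the single steps add. *)
have D m : `|\int[P]_t cos (q * (\sum_(1 <= j < m.+1) eta j t) + th) - ee ^+ m * cos th|
    <= \sum_(0 <= j < m) st j.+1.
  elim: m => [|m IH].
    rewrite big_geq// expr0 mul1r (_ : Rintegral _ _ _ = cos th) ?subrr ?normr0//.
    by under eq_Rintegral do rewrite big_geq// mulr0 add0r; exact: Ex_cst.
  rewrite big_nat_recr//=.
  pose S t := q * (\sum_(1 <= j < m.+1) eta j t) + th.
  have GS : Gmeasurable (F m) S.
    apply: GmeasurableD => //; last exact: Gmeasurable_cst.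
    by apply: GmeasurableM => //; [exact: Gmeasurable_cst|exact: adapted_sum].
  have := @clt_step m.+1 q S isT; rewrite q0 q1 => /(_ isT GS).
  rewrite (_ : \int[P]_t cos (S t + q * eta m.+1 t) =
    \int[P]_t cos (q * (\sum_(1 <= j < m.+2) eta j t) + th)); last first.
    by apply: eq_Rintegral => t _; rewrite big_nat_recr//= /S; congr cos; ring.
  rewrite -/(st m.+1) -/ee => h.
  set X := Rintegral _ _ _ in h *; set Y := \int[P]_t cos (S t) in h.
  rewrite (_ : X - _ = (X - ee * Y) + ee * (Y - ee ^+ m * cos th)); last first.
    by rewrite exprS; ring.
  rewrite (le_trans (ler_normD _ _))// addrC lerD//.
  rewrite normrM (ger0_norm (expR_ge0 _)); apply: le_trans IH.
  by rewrite ler_piMl.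
have := D n.
have -> : ee ^+ n = expR (- s2 / 2).
  rewrite /ee -expRM_natl; congr expR; rewrite q2; field; rewrite gt_eqF//.
move=> h; apply: le_trans h _.
rewrite /st !big_split/= -mulr_sumr !sumr_const_nat subn0 /bd -/q -q2.
rewrite -[_ *+ n]mulr_natl -[X in _ + _ + X <= _]mulr_natl.
have qn : n%:R * q ^+ 2 = 1 by rewrite q2 mulfV// gt_eqF.
have -> : n%:R * (q ^+ 4 * s2 ^+ 2) = (n%:R * q ^+ 2) * (q ^+ 2 * s2 ^+ 2) by ring.
have -> : n%:R * (2 * q ^+ 3 * (1 + C)) = (n%:R * q ^+ 2) * (q * (2 * (1 + C))) by ring.
by rewrite qn !mul1r; lra.
Qed.

End clt.
End martingale.

(** * Levy continuity *)

Section random_vector.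
Context {R : realType} {d : measure_display} {T : measurableType d} {p : nat}.
Variable P : probability T R.
Implicit Types (X : T -> 'cV[R]_p) (f g : 'cV[R]_p -> R).

Definition measurable_vec X := forall i, measurable_fun setT (fun t => X t i ord0).

Lemma measurable_dot (w : 'cV[R]_p) X : measurable_vec X ->
  measurable_fun setT (fun t => dot w (X t)).
Proof.
move=> mX; rewrite (_ : (fun t => _) = fun t => \sum_i w i ord0 * X t i ord0).
  by apply: measurable_sum => i; exact: measurable_funM.
by apply/funext => t; rewrite dotE.
Qed.

Lemma measurable_enorm X : measurable_vec X -> measurable_fun setT (fun t => enorm (X t)).
Proof.
move=> mX.
have ms : measurable_fun setT (@Num.sqrt R).
  by apply: continuous_measurable_fun; exact: sqrt_continuous.
apply: measurableT_comp ms _.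
by apply: measurable_sum => i; exact: measurable_funX.
Qed.

Lemma measurable_trig g X : trigpoly g -> measurable_vec X ->
  measurable_fun setT (fun t => g (X t)).
Proof.
move=> tg mX; elim: tg => [a u th|g1 g2 _ IH1 _ IH2]; last exact: measurable_funD.
apply: measurable_funM => //; apply: measurableT_comp (@measurable_cos R) _.
by apply: measurable_funD => //; exact: measurable_dot.
Qed.

Lemma box_mono (L L' : R) (x : 'cV[R]_p) : L <= L' -> box L x -> box L' x.
Proof. by move=> LL' xL i; exact: le_trans (xL i) _. Qed.

(** Measurability is assumed coordinatewise only; [f] is a pointwise limit of trigonometric
    polynomials, the [n]-th being within [1 / n.+1] of [f] on the box of radius [n.+1]. *)
Lemma measurable_continuous_vec f (B : R) X : continuous f ->
  (forall x, `|f x| <= B) -> measurable_vec X -> measurable_fun setT (fun t => f (X t)).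
Proof.
move=> cf fB mX.
have H n : exists g, trigpoly g /\ forall x, box n.+1%:R x -> `|f x - g x| <= n.+1%:R^-1.
  have n0 : 0 < n.+1%:R :> R by rewrite ltr0n.
  have ni : 0 < n.+1%:R^-1 :> R by rewrite invr_gt0.
  by have [g tg [_ h]] := trig_dense cf fB n0 ni; exists g.
have [g Hg] := choice H.
apply: (@measurable_fun_cvg _ _ _ setT (fun n t => g n (X t))) => //.
  by move=> n; apply: measurable_trig mX; case: (Hg n).
move=> t _; apply/cvgrPdist_le => e e0.
pose N := (Num.truncn (enorm (X t))).+1.
have [M HM] := eventually_le (@cvg_invn0 R) e0.
exists (maxn N M) => // n /=; rewrite geq_max => /andP[Nn Mn].
have [_ h] := Hg n.
have := HM n.+1 (leqW Mn); rewrite ger0_norm ?invr_ge0//; apply: le_trans; apply: h.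
move=> i; apply: le_trans (coord_le_enorm _ _) _.
have /ltW/le_trans -> // : enorm (X t) < N%:R by exact: truncnS_gt.
by rewrite ler_nat leqW.
Qed.

(** [psi] is an integrable majorant of the indicator of leaving the box; off the box the two
    functions differ by at most [2 * B + e]. *)
Lemma Ex_approx f g X (psi : T -> R) (B L e : R) : continuous f -> trigpoly g ->
  measurable_vec X ->
  (forall x, `|f x| <= B) -> (forall x, `|g x| <= B + e) -> 0 <= e ->
  (forall x, box L x -> `|f x - g x| <= e) ->
  intble P psi -> (forall t, 0 <= psi t) -> (forall t, ~ box L (X t) -> 1 <= psi t) ->
  `|\int[P]_t f (X t) - \int[P]_t g (X t)| <= e + (2 * B + e) * \int[P]_t psi t.
Proof.
move=> cf tg mX fB gB e0 fg jpsi psi0 psi1.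
have B0 : 0 <= B by exact: le_trans (fB 0).
have jf : intble P (fun t => f (X t)).
  apply: (intble_bounded P (B := B)) => //; exact: measurable_continuous_vec fB mX.
have jg : intble P (fun t => g (X t)).
  by apply: (intble_bounded P (B := B + e)) => //; exact: measurable_trig.
rewrite -RintegralB// -[X in X + _](Ex_cst P) -RintegralZl// -RintegralD//; last 2 first.
- exact: intble_cst.
- exact: intbleZ.
have c0 : 0 <= 2 * B + e by rewrite addr_ge0// mulr_ge0.
apply: normr_Ex_le; first exact: intbleB.
  by apply: intbleD; [exact: intble_cst|exact: intbleZ].
move=> t; have [xL|xL] := pselect (box L (X t)).
  by rewrite (le_trans (fg _ xL))// lerDl mulr_ge0.
apply: le_trans (ler_normB _ _) _.
have : (2 * B + e) * 1 <= (2 * B + e) * psi t by apply: ler_wpM2l => //; exact: psi1.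
by have := fB (X t); have := gB (X t); lra.
Qed.

(** [min(1, |X| / n.+1)] dominates the indicator of leaving a box of radius [n.+1] and tends to 0
    pointwise, so bounded convergence applies. No moment is required, which suits a limit [Y] known
    by its characteristic function. *)
Lemma tight_single X : measurable_vec X -> forall e : R, 0 < e ->
  exists2 L0 : R, 0 < L0 & forall L, L0 <= L -> exists psi : T -> R,
    [/\ intble P psi, forall t, 0 <= psi t, forall t, ~ box L (X t) -> 1 <= psi t
      & \int[P]_t psi t <= e].
Proof.
move=> mX e e0.
pose psi n t := Num.min 1 (n.+1%:R^-1 * enorm (X t)).
have psi0 n t : 0 <= psi n t.
  by rewrite le_min ler01 mulr_ge0 ?enorm_ge0.
have mpsi n : measurable_fun setT (psi n).
  apply: measurable_minr => //; apply: measurable_funM => //.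
  exact: measurable_enorm.
have [] := @Ex_dct R d T P psi (fun=> 0) (fun=> 1) mpsi _ (intble_cst P 1).
- exact: measurable_cst.
- move=> t; apply: (@cvg0_le R _ (fun n => n.+1%:R^-1 * enorm (X t)) 0).
    by move=> n _; rewrite ger0_norm// ge_min lexx orbT.
  apply: cvg0Mr; have := @cvg_invn0 R; rewrite -cvg_shiftS; exact.
- by move=> n t; rewrite ger0_norm// ge_min lexx.
rewrite Ex_cst => _ /eventually_le /(_ e0)[N HN].
exists N.+1%:R; first by rewrite ltr0n.
move=> L NL; exists (psi N); split => //.
- apply: (intble_bounded P (B := 1)) => // t; rewrite ger0_norm// ge_min lexx//.
- move=> t xL; rewrite le_min lexx/=.
  rewrite ler_pdivlMl ?ltr0n// mulr1 leNgt; apply/negP => h; apply: xL => i.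
  by apply: le_trans (coord_le_enorm _ _) _; apply: le_trans (ltW h) _.
- by have := HN N (leqnn N); apply: le_trans; exact: ler_norm.
Qed.

End random_vector.

Section levy.
Context {R : realType} {p : nat}.
Context {d : measure_display} {T : measurableType d} (P : probability T R).
Context {d' : measure_display} {T' : measurableType d'} (P' : probability T' R).
Variables (X : nat -> T -> 'cV[R]_p) (Y : T' -> 'cV[R]_p).
Hypotheses (mX : forall n, measurable_vec (X n)) (mY : measurable_vec Y).
Hypothesis tightX : forall e : R, 0 < e -> exists (L : R) (N : nat), forall n, (N <= n)%N ->
  exists psi : T -> R,
    [/\ intble P psi, forall t, 0 <= psi t, forall t, ~ box L (X n t) -> 1 <= psi t
      & \int[P]_t psi t <= e].
Hypothesis cfX : forall u th,
  (fun n => \int[P]_t cos (dot u (X n t) + th)) @ \oo --> \int[P']_t cos (dot u (Y t) + th).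

Lemma trig_cvg g : trigpoly g ->
  (fun n => \int[P]_t g (X n t)) @ \oo --> \int[P']_t g (Y t).
Proof.
have jT (d0 : measure_display) (T0 : measurableType d0) (P0 : probability T0 R)
    (X0 : T0 -> 'cV[R]_p) h : trigpoly h -> measurable_vec X0 ->
    intble P0 (fun t => h (X0 t)).
  move=> th mX0; have [B _ HB] := trig_bounded th.
  by apply: (intble_bounded P0 (B := B)) => //; exact: measurable_trig.
elim=> [a u th|g1 g2 t1 IH1 t2 IH2].
  have jc (d0 : measure_display) (T0 : measurableType d0) (P0 : probability T0 R)
    (X0 : T0 -> 'cV[R]_p) : measurable_vec X0 -> intble P0 (fun t => cos (dot u (X0 t) + th)).
    move=> m0; have := jT _ _ P0 X0 _ (trig_cos 1 u th) m0.
    by congr integrable; apply/funext => t /=; rewrite mul1r.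
  rewrite RintegralZl//; last exact: jc.
  under eq_fun do (rewrite RintegralZl//; last exact: jc).
  by apply: cvgMl_tmp; exact: cfX.
rewrite RintegralD//; [|exact: jT|exact: jT].
under eq_fun do (rewrite RintegralD//; [|exact: jT|exact: jT]).
exact: cvgD.
Qed.

Lemma levy_continuity f (B : R) : continuous f -> (forall x, `|f x| <= B) ->
  (\int[P]_t (f (X n t))%:E)%E @[n --> \oo] --> (\int[P']_t (f (Y t))%:E)%E.
Proof.
move=> cf fB.
have B0 : 0 <= B by exact: le_trans (fB 0).
have jX n : intble P (fun t => f (X n t)).
  by apply: (intble_bounded P (B := B)) => //; exact: measurable_continuous_vec fB (mX n).
have jY : intble P' (fun t => f (Y t)).
  by apply: (intble_bounded P' (B := B)) => //; exact: measurable_continuous_vec fB mY.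
rewrite Ex_EFin//; under eq_fun do rewrite Ex_EFin//.
apply: cvg_EFin; first exact: nearW.
apply/cvgrPdist_le => eps eps0.
(* Error budget: [eps / 4] for each of [X n] and [Y], made of [eps / 8] on the box and [eps / 8] off
   it, and [eps / 2] for the convergence of the trigonometric polynomial. The cap [e <= 1] gives
   [2 * B + e <= c]. *)
pose e := Num.min 1 (eps / 8).
have e0 : 0 < e by rewrite lt_min ltr01 divr_gt0.
pose c := 2 * B + 1; have c0 : 0 < c by rewrite /c ltr_wpDl// mulr_ge0.
have e1 : 0 < eps / 8 / c by rewrite !divr_gt0.
have [L1 [N HN]] := tightX e1.
have [L2 L20 HL2] := tight_single P' mY e1.
pose L := Num.max L1 L2.
have L0 : 0 < L by rewrite /L lt_max L20 orbT.
have [g tg [gB fg]] := trig_dense cf fB L0 e0.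
have eps2 : 0 < eps / 2 by rewrite divr_gt0.
have [M _ HM] := (cvgrPdist_le _ _).1 (trig_cvg tg) _ eps2.
have err z : 0 <= z -> z <= eps / 8 / c -> e + (2 * B + e) * z <= eps / 4.
  move=> z0; rewrite ler_pdivlMr// => zc.
  have h1 : e <= eps / 8 by rewrite ge_min lexx orbT.
  have h2 : (2 * B + e) * z <= c * z.
    by apply: ler_wpM2r => //; rewrite /c lerD2l ge_min lexx.
  by rewrite mulrC in zc; lra.
have [psi' [jp' p0' p1' Ep']] := HL2 L ltac:(by rewrite /L le_max lexx orbT).
have EY := Ex_approx cf tg mY fB gB (ltW e0) fg jp' p0' p1'.
have {}EY := le_trans EY (err _ (@Rintegral_ge0 _ _ _ P' setT psi' (fun t _ => p0' t)) Ep').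
exists (maxn N M) => // n /=; rewrite geq_max => /andP[Nn Mn].
have [psi [jp p0 p1 Ep]] := HN n Nn.
have p1L t : ~ box L (X n t) -> 1 <= psi t.
  move=> h; apply: p1 => hb; apply: h; apply: box_mono hb.
  by rewrite /L le_max lexx.
have EX := Ex_approx cf tg (mX n) fB gB (ltW e0) fg jp p0 p1L.
have {}EX := le_trans EX (err _ (@Rintegral_ge0 _ _ _ P setT psi (fun t _ => p0 t)) Ep).
have tri (a1 a2 a3 a4 : R) : `|a1 - a2| <= eps / 4 -> `|a3 - a4| <= eps / 4 ->
    `|a4 - a2| <= eps / 2 -> `|a3 - a1| <= eps.
  move=> h1 h2 h3.
  rewrite (_ : a3 - a1 = (a3 - a4) + (a4 - a2) - (a1 - a2)); last by ring.
  rewrite (le_trans (ler_normB _ _))//.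
  by have := ler_normD (a3 - a4) (a4 - a2); lra.
exact: tri EX EY (HM n Mn).
Qed.

End levy.

(** * Conditional variances of the noise *)

Section conditional_variance.
Context {R : realType} {d : measure_display} {T : measurableType d}.
Variables (P : probability T R) (G : set (set T)).
Hypotheses (sG : sigma_algebra setT G) (GT : G `<=` measurable).

Lemma Gmeasurable_indic (B : set T) : G B -> Gmeasurable G (\1_B : T -> R).
Proof.
move=> GB; apply/(GmeasurableP sG).
apply: (@measurable_indic _ (g_sigma_algebraType G) R setT B).
exact: sub_sigma_algebra.
Qed.

(** Split along the exceptional event [B]. Outside, [Z (1 - 1_B)] is [G]-measurable, so [eta^2] may
    be replaced by its conditional expectation [s], which is within [e] of [s2]. On [B],
    [eta^2 <= dl eta^4 + 1 / dl] trades the variance for the fourth moment and [P B]. *)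
Lemma cond_var_bound (eta s Z : T -> R) (B : set T) (s2 C e dl : R) :
  is_cond_exp P G (fun t => eta t ^+ 2) s -> measurable_fun setT eta ->
  intble P (fun t => eta t ^+ 4) -> \int[P]_t (eta t ^+ 4) <= C ->
  0 <= s2 -> 0 <= e -> 0 < dl -> G B -> (forall t, ~ B t -> `|s t - s2| <= e) ->
  Gmeasurable G Z -> (forall t, `|Z t| <= 1) ->
  `|\int[P]_t (Z t * (eta t ^+ 2 - s2))| <= e + dl * C + (dl^-1 + s2) * fine (P B).
Proof.
move=> ce me j4 E4 s20 e0 dl0 GB Bs GZ Z1.
have mZ := Gmeasurable_mfun GT GZ.
have mB := GT GB; have GI := Gmeasurable_indic GB.
have mI := Gmeasurable_mfun GT GI.
pose I := (\1_B : T -> R).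
have I01 t : I t = 0 \/ I t = 1 by rewrite /I indicE; case: (_ \in _); [right|left].
pose Z' t := Z t * (1 - I t).
have GZ' : Gmeasurable G Z'.
  apply: GmeasurableM => //; apply: GmeasurableD => //; first exact: Gmeasurable_cst.
  rewrite (_ : (fun t => - I t) = fun t => (-1) * I t); last first.
    by apply/funext => t; rewrite mulN1r.
  by apply: GmeasurableM => //; exact: Gmeasurable_cst.
have mZ' := Gmeasurable_mfun GT GZ'.
have Z'1 t : `|Z' t| <= 1.
  by rewrite /Z'; case: (I01 t) => ->; rewrite ?subr0 ?mulr1// subrr mulr0 normr0.
have [j2 [Gs [js _]]] := ce.
have jc : intble P (fun=> s2) := intble_cst P s2.
have jZe : intble P (fun t => Z' t * eta t ^+ 2) by exact: (intbleM_bdd (B := 1)).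
have jZs : intble P (fun t => Z' t * s t) by exact: (intbleM_bdd (B := 1)).
have jZc : intble P (fun t => Z' t * s2) by exact: (intbleM_bdd (B := 1)).
have j1 : intble P (fun t => Z' t * (s t - s2)).
  by apply: (intbleM_bdd (B := 1)) => //; exact: intbleB.
have jI : intble P (fun t => Z t * I t * (eta t ^+ 2 - s2)).
  apply: (intbleM_bdd (B := 1)); first exact: measurable_funM.
    exact: intbleB.
  by move=> t; case: (I01 t) => ->; rewrite ?mulr1// mulr0 normr0.
have jIe : intble P I.
  by apply: (intble_bounded P (B := 1)) => // t; case: (I01 t) => ->; rewrite ?normr0 ?normr1.
have -> : \int[P]_t (Z t * (eta t ^+ 2 - s2)) =
    \int[P]_t (Z' t * (s t - s2)) + \int[P]_t (Z t * I t * (eta t ^+ 2 - s2)).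
  have -> : \int[P]_t (Z' t * (s t - s2)) = \int[P]_t (Z' t * (eta t ^+ 2 - s2)).
    under eq_Rintegral do rewrite mulrBr.
    under [RHS]eq_Rintegral do rewrite mulrBr.
    by rewrite !RintegralB// (cond_exp_mul GT ce GZ').
  rewrite -RintegralD//.
    by apply: eq_Rintegral => t _; rewrite /Z'; ring.
  by apply: (intbleM_bdd (B := 1)) => //; exact: intbleB.
have EI : \int[P]_t I t = fine (P B).
  by rewrite /Rintegral integral_indic// setIT.
apply: le_trans (ler_normD _ _) _; rewrite -addrA; apply: lerD.
  rewrite -[leRHS](Ex_cst P); apply: normr_Ex_le => //; first exact: intble_cst.
  move=> t; have [Bt|Bt] := pselect (B t).
    by rewrite /Z' /I indicE mem_set// subrr mulr0 mul0r normr0.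
  rewrite normrM; apply: le_trans (ler_piMl _ _) (Bs t Bt) => //.
have jb : intble P (fun t => dl * eta t ^+ 4 + (dl^-1 + s2) * I t).
  by apply: intbleD; exact: intbleZ.
apply: le_trans (_ : \int[P]_t (dl * eta t ^+ 4 + (dl^-1 + s2) * I t) <= _).
  apply: normr_Ex_le => // t.
  have h4 : 0 <= eta t ^+ 4 by exact: exprn_even_ge0.
  have hd : 0 < dl^-1 by rewrite invr_gt0.
  case: (I01 t) => ->.
    by rewrite mulr0 mul0r normr0 mulr0 addr0 mulr_ge0// ltW.
  rewrite !mulr1 normrM; apply: le_trans (ler_piMl _ (Z1 t)) _ => //.
  have h2 : eta t ^+ 2 <= dl * eta t ^+ 4 + dl^-1.
    have e4 : eta t ^+ 4 = (eta t ^+ 2) ^+ 2 by rewrite -exprM.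
    rewrite -(ler_pM2l dl0) mulrDr mulfV ?gt_eqF// e4.
    have := sqr_ge0 (dl * eta t ^+ 2 - 1); have := sqr_ge0 (dl * eta t ^+ 2).
    move: (eta t ^+ 2) => y; rewrite sqrrB expr1n mulr1 exprMn => h5 h6.
    by rewrite mulrA -expr2; lra.
  have := sqr_ge0 (eta t); rewrite ler_norml => h5; apply/andP; split; last by lra.
  have : 0 <= dl * eta t ^+ 4 by rewrite mulr_ge0// ltW.
  by lra.
rewrite RintegralD//; [|exact: intbleZ|exact: intbleZ].
rewrite !RintegralZl// EI lerD2r ler_pM2l//.
Qed.

End conditional_variance.

(** * Linear functionals of the vector noise *)

Section vector_noise.
Context {R : realType} {d : measure_display} {T : measurableType d} {p : nat}.
Variables (P : probability T R) (F : nat -> set (set T)).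
Hypothesis fF : filtration F.
Variable X : nat -> T -> 'cV[R]_p.
Hypothesis aX : forall n, Gmeasurable_vec (F n) (X n).

Let sF n : sigma_algebra setT (F n). Proof. by case: fF. Qed.
Let FT n : F n `<=` measurable. Proof. by case: fF => _ []. Qed.

Lemma adapted_mvec n : measurable_vec (X n).
Proof. by move=> i; apply: Gmeasurable_mfun (aX n i); exact: FT. Qed.

(** Deterministic weights preserve the martingale difference property, so orthogonality leaves only
    the squares, and Cauchy-Schwarz separates weight from noise. *)
Lemma weighted_sum_sqr (w : nat -> 'cV[R]_p) (x : nat -> R) n :
  (forall k, (0 < k)%N -> forall i,
    is_cond_exp P (F k.-1) (fun t => X k t i ord0) (fun=> 0)) ->
  (forall k, (0 < k)%N -> intble P (fun t => enorm (X k t) ^+ 2)) ->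
  (forall k, (0 < k)%N -> \int[P]_t (enorm (X k t) ^+ 2) <= x k) ->
  intble P (fun t => (\sum_(1 <= k < n.+1) dot (w k) (X k t)) ^+ 2) /\
  \int[P]_t ((\sum_(1 <= k < n.+1) dot (w k) (X k t)) ^+ 2) <=
    \sum_(1 <= k < n.+1) enorm (w k) ^+ 2 * x k.
Proof.
move=> cX jX Xx.
have sq k t : dot (w k) (X k t) ^+ 2 <= enorm (w k) ^+ 2 * enorm (X k t) ^+ 2.
  rewrite -exprMn -real_normK ?num_real// ler_sqr ?cauchy_schwarz// nnegrE//.
  by rewrite mulr_ge0 ?enorm_ge0.
have jw k : (0 < k)%N -> intble P (fun t => dot (w k) (X k t) ^+ 2).
  move=> k0; apply: (intble_le (g := fun t => enorm (w k) ^+ 2 * enorm (X k t) ^+ 2)).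
  - by apply: measurable_funX; apply: measurable_dot; exact: adapted_mvec.
  - by apply: intbleZ; exact: jX.
  - by move=> t; rewrite ger0_norm ?sqr_ge0.
have [||//|j ->] := @orthogonal_sum R d T P F fF (fun k t => dot (w k) (X k t)) n.
- by move=> k _; exact: Gmeasurable_dot.
- by move=> k k0; apply: cond_exp_dot0 => //; exact: cX.
split=> //; rewrite big_nat [leRHS]big_nat; apply: ler_sum => k /andP[k0 _].
apply: le_trans (_ : enorm (w k) ^+ 2 * \int[P]_t (enorm (X k t) ^+ 2) <= _).
  rewrite -RintegralZl//; last exact: jX.
  by apply: Ex_le => //; [exact: jw|apply: intbleZ; exact: jX].
by apply: ler_wpM2l; [exact: sqr_ge0|exact: Xx].
Qed.

Lemma dot_fourth_moment (v : 'cV[R]_p) (C : R) k :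
  intble P (fun t => enorm (X k t) ^+ 4) -> \int[P]_t (enorm (X k t) ^+ 4) <= C ->
  intble P (fun t => dot v (X k t) ^+ 4) /\
  \int[P]_t (dot v (X k t) ^+ 4) <= enorm v ^+ 4 * C.
Proof.
move=> j4 E4.
have sq t : dot v (X k t) ^+ 4 <= enorm v ^+ 4 * enorm (X k t) ^+ 4.
  rewrite -exprMn -[leLHS]ger0_norm ?exprn_even_ge0// normrX.
  by apply: lerXn2r; rewrite ?nnegrE ?cauchy_schwarz// mulr_ge0 ?enorm_ge0.
have jb : intble P (fun t => enorm v ^+ 4 * enorm (X k t) ^+ 4) by exact: intbleZ.
have jd : intble P (fun t => dot v (X k t) ^+ 4).
  apply: (intble_le _ jb) => [|t]; last by rewrite ger0_norm ?exprn_even_ge0.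
  by apply: measurable_funX; apply: measurable_dot; exact: adapted_mvec.
split=> //; apply: le_trans (Ex_le jd jb sq) _.
by rewrite RintegralZl//; apply: ler_wpM2l => //; rewrite exprn_ge0 ?enorm_ge0.
Qed.

Lemma uniform_variance (v : 'cV[R]_p) (Sigma : 'M[R]_p) (V : nat -> T -> 'M[R]_p) (C : R) :
  0 <= C ->
  (forall k, (0 < k)%N -> intble P (fun t => enorm (X k t) ^+ 4)) ->
  (forall k, (0 < k)%N -> \int[P]_t (enorm (X k t) ^+ 4) <= C) ->
  (forall k, (0 < k)%N -> forall i j,
    is_cond_exp P (F k.-1) (fun t => (X k t *m (X k t)^T) i j) (fun t => V k t i j)) ->
  cvg_in_prob P V Sigma -> 0 <= dot v (Sigma *m v) ->
  exists2 b : nat -> R, b @ \oo --> 0 & forall k Z, (0 < k)%N ->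
    Gmeasurable (F k.-1) Z -> (forall t, `|Z t| <= 1) ->
    `|\int[P]_t (Z t * (dot v (X k t) ^+ 2 - dot v (Sigma *m v)))| <= b k.
Proof.
move=> C0 j4 E4 cV cvgV; set s2 := dot v (Sigma *m v) => s20.
pose C' := enorm v ^+ 4 * C.
have C'0 : 0 <= C' by rewrite mulr_ge0// exprn_ge0// enorm_ge0.
have j4' k (k0 : (0 < k)%N) := dot_fourth_moment v (j4 k k0) (E4 k k0).
have mdot k : measurable_fun setT (fun t => dot v (X k t)).
  by apply: measurable_dot; exact: adapted_mvec.
pose val k Z := `|\int[P]_t (Z t * (dot v (X k t) ^+ 2 - s2))|.
pose adm k := [set Z : T -> R | Gmeasurable (F k.-1) Z /\ forall t, `|Z t| <= 1].
have bd k Z : (0 < k)%N -> adm k Z -> val k Z <= 1 + C' + s2.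
  move=> k0 [GZ Z1]; have [j E] := j4' k k0.
  have mZ := Gmeasurable_mfun (FT (n := _)) GZ.
  have jb : intble P (fun t => (1 + dot v (X k t) ^+ 4) + s2).
    by apply: intbleD; [apply: intbleD => //|]; exact: intble_cst.
  apply: le_trans (normr_Ex_le _ jb _) _.
  - apply: (intbleM_bdd (B := 1)) => //; apply: intbleB; last exact: intble_cst.
    exact: intble_sqr4.
  - move=> t; rewrite normrM; apply: le_trans (ler_piMl _ (Z1 t)) _ => //.
    apply: le_trans (ler_normB _ _) _; rewrite (ger0_norm s20) lerD2r.
    by rewrite ger0_norm ?sqr_ge0// (le1D_expr4 _).2.
  rewrite RintegralD//; [|by apply: intbleD => //; exact: intble_cst|exact: intble_cst].
  rewrite RintegralD//; last exact: intble_cst.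
  by rewrite !Ex_cst lerD2r lerD2l.
(* The best uniform bound: the set is bounded by [bd] and contains 0, the value at [Z = 0], so the
   supremum is genuine and nonnegative for [0 < k]. *)
pose b k := sup [set val k Z | Z in adm k].
exists b; last first.
  move=> k Z k0 GZ Z1; apply: ub_le_sup; last by exists Z.
  by exists (1 + C' + s2) => _ [Z' hZ' <-]; exact: bd.
have val0 k : val k (fun=> 0) = 0.
  rewrite /val (_ : Rintegral _ _ _ = 0) ?normr0//.
  by under eq_Rintegral do rewrite mul0r; exact: Ex_cst.
have adm0 k : adm k (fun=> 0).
  by split; [exact: Gmeasurable_cst|move=> t; rewrite normr0].
apply/cvgr0Pnorm_le => ep ep0.
pose e := ep / 3; have e0 : 0 < e by rewrite divr_gt0.
(* Each of the three terms of [cond_var_bound] gets [ep / 3]: [dl] settles the fourth moment, [e']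
   turns a matrix distance into a bound on the quadratic form at [v], and [N] then makes the
   exceptional probability small. The added ones avoid division by 0. *)
pose dl := e / (C' + 1); have C'1 : 0 < C' + 1 by rewrite ltr_wpDl.
have dl0 : 0 < dl by rewrite divr_gt0.
pose e' := e / (enorm v ^+ 2 + 1).
have v1 : 0 < enorm v ^+ 2 + 1 by rewrite ltr_wpDl ?sqr_ge0.
have e'0 : 0 < e' by rewrite divr_gt0.
pose B k := [set t | e' < fnorm (V k t - Sigma)].
have PB0 : (fun k => fine (P (B k))) @ \oo --> 0.
  by apply: fine_cvg; exact: cvgV.
have c0 : 0 < dl^-1 + s2 by rewrite ltr_wpDr// invr_gt0.
have ec : 0 < e / (dl^-1 + s2) by rewrite divr_gt0.
have [N HN] := eventually_le PB0 ec.
exists N.+1 => // k /= Nk; have k0 : (0 < k)%N := leq_ltn_trans (leq0n N) Nk.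
have hb Z : adm k Z -> val k Z <= ep.
  move=> [GZ Z1]; have [j E] := j4' k k0.
  have GB : F k.-1 (B k).
    have Gf : Gmeasurable (F k.-1) (fun t => fnorm (V k t - Sigma)).
      apply: (Gmeasurable_comp (sF _) (h := @Num.sqrt R)).
        by apply: continuous_measurable_fun; exact: sqrt_continuous.
      apply: Gmeasurable_sum => // i; apply: Gmeasurable_sum => // j'.
      have [_ [GV _]] := cV k k0 i j'.
      have GVS : Gmeasurable (F k.-1) (fun t => V k t i j' - Sigma i j').
        by apply: GmeasurableD => //; exact: Gmeasurable_cst.
      have := GmeasurableM (sF _) GVS GVS; congr Gmeasurable.
      by apply/funext => t; rewrite !mxE expr2.
    have := Gf `]e', +oo[%classic (measurable_itv _).
    congr (F k.-1 _); apply/seteqP; split=> t /=; rewrite in_itv/= andbT//.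
  have ce := cond_exp_quadratic (sF _) (FT (n := _)) v (cV k k0).
  have Bs t : ~ B k t -> `|dot v (V k t *m v) - s2| <= e.
    move=> /negP; rewrite -leNgt => h.
    rewrite /s2 -dotNr -dotDr -mulNmx -mulmxDl.
    apply: le_trans (dot_mulmx_le _ _) _.
    apply: le_trans (_ : e' * (enorm v ^+ 2 + 1) <= _); last by rewrite divfK// gt_eqF.
    by apply: ler_pM => //; [exact: sqrtr_ge0|exact: sqr_ge0|rewrite lerDl].
  apply: le_trans (cond_var_bound (sF _) (FT (n := _)) ce (mdot k) j E s20 (ltW e0)
    dl0 GB Bs GZ Z1) _.
  have h1 : dl * C' <= e.
    by rewrite /dl mulrAC ler_pdivrMr// ler_pM2l// lerDl.
  have h2 : (dl^-1 + s2) * fine (P (B k)) <= e.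
    have := HN k (ltnW Nk); rewrite ler_pdivlMr// mulrC.
    by apply: le_trans; rewrite ler_pM2l// ler_norm.
  apply: le_trans (lerD (lerD (lexx e) h1) h2) _.
  by rewrite /e; lra.
have ub : [set val k Z | Z in adm k] 0 by exists (fun=> 0).
rewrite ger0_norm.
  by apply: ge_sup => [|_ [Z hZ <-]]; [exists 0|exact: hb].
by apply: ub_le_sup => //; exists ep => _ [Z hZ <-]; exact: hb.
Qed.

End vector_noise.

(** * The averaged iterates *)

Lemma cvg0_sum {R : realType} (I : Type) (r : seq I) (u : I -> nat -> R) :
  (forall i, u i @ \oo --> 0) -> (fun n => \sum_(i <- r) u i n) @ \oo --> 0.
Proof.
move=> u0; elim: r => [|i r IH].
  by under eq_fun do rewrite big_nil; exact: cvg_cst.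
by under eq_fun do rewrite big_cons; exact: cvg0D.
Qed.

(** Only the second summand keeps the truncation, as the first will be controlled in mean. *)
Lemma min1_leD {R : realType} (x a b : R) : 0 <= a -> 0 <= b -> x <= a + b ->
  Num.min 1 x <= a + Num.min 1 b.
Proof.
move=> a0 b0 xab; have [b1|b1] := leP 1 b.
  by apply: le_trans (_ : 1 <= _); [rewrite ge_min lexx|rewrite lerDr].
by rewrite ge_min xab orbT.
Qed.

Section averaged_iterates.
Context {R : realType} {d : measure_display} {T : measurableType d} {p : nat}.
Variables (P : probability T R) (F : nat -> set (set T)) (A : 'M[R]_p) (gamma : nat -> R).
Variables (eps xi e : nat -> T -> 'cV[R]_p) (Delta0 : 'cV[R]_p).
Variable Delta : nat -> T -> 'cV[R]_p.
Hypothesis fF : filtration F.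
Hypothesis aeps : forall n, Gmeasurable_vec (F n) (eps n).
Hypothesis axi : forall n, Gmeasurable_vec (F n) (xi n).
Hypothesis ae : forall n, Gmeasurable_vec (F n) (e n).
Hypothesis gamma_gt0 : forall n, (0 < n)%N -> 0 < gamma n.
Hypothesis Delta_0 : forall t, Delta 0%N t = Delta0.
Hypothesis Delta_rec : forall n t, (0 < n)%N ->
  Delta n t = Delta n.-1 t - gamma n *: (A *m Delta n.-1 t)
              + gamma n *: (eps n t + xi n t + e n t).
Hypothesis pA : sym_posdef A.
Hypothesis ceps : forall k, (0 < k)%N -> forall i,
  is_cond_exp P (F k.-1) (fun t => eps k t i ord0) (fun=> 0).
Hypothesis cxi : forall k, (0 < k)%N -> forall i,
  is_cond_exp P (F k.-1) (fun t => xi k t i ord0) (fun=> 0).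
Variables (M K : R) (x : nat -> R) (N : nat).
Hypothesis jeps : forall k, (0 < k)%N -> intble P (fun t => enorm (eps k t) ^+ 2).
Hypothesis Eeps : forall k, (0 < k)%N -> \int[P]_t (enorm (eps k t) ^+ 2) <= M.
Hypothesis jxi : forall k, (0 < k)%N -> intble P (fun t => enorm (xi k t) ^+ 2).
Hypothesis Exi : forall k, (0 < k)%N -> \int[P]_t (enorm (xi k t) ^+ 2) <= x k.
Hypothesis x_cvg0 : x @ \oo --> 0.
Hypothesis je : forall k, (N <= k)%N -> intble P (fun t => enorm (e k t)).
Hypothesis Ee : forall k, (N <= k)%N -> \int[P]_t (enorm (e k t)) <= K * gamma k.
Hypothesis gamma0 : gamma @ \oo --> 0.
Hypothesis dgamma0 :
  (fun n => ((gamma n - gamma n.-1) / gamma n) / gamma n) @ \oo --> 0.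
Hypothesis gamma_sum : cvg (series (fun j => gamma j.+1 / Num.sqrt j.+1%:R) @ \oo).

Definition scaled_mean n t : 'cV[R]_p :=
  Num.sqrt n%:R *: (n%:R^-1 *: \sum_(1 <= i < n.+1) Delta i t).

Let q n : R := (Num.sqrt n%:R)^-1.

Definition main_term u n t :=
  q n * \sum_(1 <= k < n.+1) dot (invmx A *m u) (eps k t).

Definition remainder u n t := dot u (scaled_mean n t) - main_term u n t.

Let q0 n : 0 <= q n. Proof. by rewrite invr_ge0 sqrtr_ge0. Qed.

Let q2 n : q n ^+ 2 = n%:R^-1. Proof. by rewrite /q exprVn sqr_sqrtr. Qed.

Lemma measurable_Delta n : measurable_vec (Delta n).
Proof.
elim: n => [|n IH] i.
  rewrite (_ : (fun t => _) = fun=> Delta0 i ord0); first exact: measurable_cst.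
  by apply/funext => t; rewrite Delta_0.
rewrite (_ : (fun t => _) = fun t => Delta n t i ord0
    - gamma n.+1 * (\sum_j A i j * Delta n t j ord0)
    + gamma n.+1 * (eps n.+1 t i ord0 + xi n.+1 t i ord0 + e n.+1 t i ord0)); last first.
  by apply/funext => t; rewrite Delta_rec//= !mxE.
have m1 := adapted_mvec fF aeps n.+1 i.
have m2 := adapted_mvec fF axi n.+1 i; have m3 := adapted_mvec fF ae n.+1 i.
apply: measurable_funD; last first.
  by apply: measurable_funM => //; apply: measurable_funD => //; exact: measurable_funD.
apply: measurable_funB => //; apply: measurable_funM => //.
by apply: measurable_sum => j; exact: measurable_funM.
Qed.

Lemma measurable_scaled_mean n : measurable_vec (scaled_mean n).
Proof.
move=> i; rewrite (_ : (fun t => _) = fun t =>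
    Num.sqrt n%:R * (n%:R^-1 * \sum_(1 <= k < n.+1) Delta k t i ord0)).
  do 2 apply: measurable_funM => //.
  by apply: measurable_sum => k; exact: measurable_Delta.
by apply/funext => t; rewrite !mxE summxE.
Qed.

Lemma measurable_main u n : measurable_fun setT (main_term u n).
Proof.
apply: measurable_funM => //; apply: measurable_sum => k; apply: measurable_dot.
exact: (adapted_mvec fF aeps).
Qed.

Lemma measurable_remainder u n : measurable_fun setT (remainder u n).
Proof.
apply: measurable_funB; last exact: measurable_main.
by apply: measurable_dot; exact: measurable_scaled_mean.
Qed.

Let noise_sum (X : nat -> T -> 'cV[R]_p) (w : nat -> 'cV[R]_p) n t :=
  q n * \sum_(1 <= k < n.+1) dot (w k) (X k t).

Let W u n k := weight A gamma u n k.

Lemma remainder_decomp u n t : (0 < n)%N -> remainder u n t =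
  q n * ((gamma 1%N)^-1 * dot (W u n 1) (Delta0 - gamma 1%N *: (A *m Delta0)))
  + noise_sum eps (fun k => W u n k - invmx A *m u) n t
  + noise_sum xi (W u n) n t + noise_sum e (W u n) n t.
Proof.
move=> n0; have n0' : 0 < n%:R :> R by rewrite ltr0n.
have qE : Num.sqrt n%:R * n%:R^-1 = q n.
  rewrite -{2}(sqr_sqrtr (ltW n0')) expr2 invfM mulrA mulfV ?mul1r//.
  by rewrite gt_eqF// sqrtr_gt0.
have rec k : (0 < k)%N -> Delta k t = Delta k.-1 t - gamma k *: (A *m Delta k.-1 t)
    + gamma k *: (eps k t + xi k t + e k t) by move=> k0; exact: Delta_rec.
rewrite /remainder /scaled_mean !dotZr mulrA qE dot_sumr.
rewrite (sum_dot_weight1 u gamma_gt0 pA rec n0) Delta_0.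
rewrite /main_term /noise_sum -!mulrDr -mulrBr; congr (_ * _).
rewrite -!addrA; congr (_ + _); rewrite -sumrB -!big_split/=.
by apply: eq_bigr => k _; rewrite !dotDr !dotDl dotNl /W; ring.
Qed.

(** Serves both noises: for [eps] the weights are small on average, for [xi] they are merely bounded
    but the second moments [y k] decay. In either case the weighted second moments sum to o(n),
    which beats the normalisation. *)
Let noise_sqr (X : nat -> T -> 'cV[R]_p) (w : nat -> nat -> 'cV[R]_p) (y z : nat -> R) :
  (forall n, Gmeasurable_vec (F n) (X n)) ->
  (forall k, (0 < k)%N -> forall i,
    is_cond_exp P (F k.-1) (fun t => X k t i ord0) (fun=> 0)) ->
  (forall k, (0 < k)%N -> intble P (fun t => enorm (X k t) ^+ 2)) ->
  (forall k, (0 < k)%N -> \int[P]_t (enorm (X k t) ^+ 2) <= y k) ->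
  (forall n, \sum_(1 <= k < n.+1) enorm (w n k) ^+ 2 * y k <= z n) ->
  (fun n => n%:R^-1 * z n) @ \oo --> 0 ->
  [/\ forall n, measurable_fun setT (noise_sum X (w n) n),
      forall n, intble P (fun t => `|noise_sum X (w n) n t|)
    & (fun n => \int[P]_t `|noise_sum X (w n) n t|) @ \oo --> 0].
Proof.
move=> aX cX jX EX yz z0.
have mN n : measurable_fun setT (noise_sum X (w n) n).
  apply: measurable_funM => //; apply: measurable_sum => k; apply: measurable_dot.
  exact: (adapted_mvec fF aX).
have sqE n : (fun t => noise_sum X (w n) n t ^+ 2) =
    fun t => q n ^+ 2 * (\sum_(1 <= k < n.+1) dot (w n k) (X k t)) ^+ 2.
  by apply/funext => t; rewrite /noise_sum exprMn.
have js n : intble P (fun t => noise_sum X (w n) n t ^+ 2).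
  by rewrite sqE; apply: intbleZ; have [] := weighted_sum_sqr fF aX (w n) n cX jX EX.
split=> // [n|].
  apply: (intble_le (g := fun t => 1 + noise_sum X (w n) n t ^+ 2)).
  - exact: measurableT_comp.
  - by apply: intbleD => //; exact: intble_cst.
  - move=> t; rewrite normr_id -[X in _ <= _ + X]real_normK ?num_real//.
    move: `|noise_sum _ _ _ _| => r; have := sqr_ge0 (r - 1); have := sqr_ge0 r.
    by rewrite sqrrB expr1n mulr1; lra.
apply: sqr_cvg0_norm_cvg0 => //.
apply: (@cvg0_le _ _ (fun n => n%:R^-1 * z n) 0) => // n _.
have [j h] := weighted_sum_sqr fF aX (w n) n cX jX EX.
rewrite ger0_norm; last by apply: Rintegral_ge0 => t _; exact: sqr_ge0.
rewrite (_ : \int[P]_t _ = q n ^+ 2 *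
  \int[P]_t ((\sum_(1 <= k < n.+1) dot (w n k) (X k t)) ^+ 2)); last first.
  by rewrite -RintegralZl// -sqE.
by rewrite q2; apply: ler_wpM2l; [rewrite invr_ge0|exact: le_trans h (yz n)].
Qed.

(** The early bias terms may have infinite mean, but they are finitely many and finite pathwise, so
    truncation at 1 and bounded convergence dispose of them; all other pieces are bounded in
    mean. *)
Lemma remainder_cvg0 u :
  (fun n => \int[P]_t Num.min 1 `|remainder u n t|) @ \oo --> 0.
Proof.
have [[Bd Bd0 HBd] mean0] := weight_limit u gamma_gt0 pA gamma0 dgamma0.
have M0 : 0 <= M.
  by apply: le_trans (Eeps (k := 1) isT); apply: Rintegral_ge0 => t _; exact: sqr_ge0.
have x0 k : (0 < k)%N -> 0 <= x k.
  by move=> k0; apply: le_trans (Exi k0); apply: Rintegral_ge0 => t _; exact: sqr_ge0.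
pose v := invmx A *m u.
pose B := Bd + enorm v; have B0 : 0 <= B by rewrite addr_ge0 ?enorm_ge0.
have WB n k : (0 < k <= n)%N -> enorm (W u n k) <= B.
  move=> kn; rewrite -(subrK v (W u n k)); apply: le_trans (enormD _ _) _.
  by rewrite lerD2r; exact: HBd.
have [m2 j2 r2] : [/\ forall n, measurable_fun setT
        (noise_sum eps (fun k => W u n k - v) n),
      forall n, intble P (fun t => `|noise_sum eps (fun k => W u n k - v) n t|)
    & (fun n => \int[P]_t `|noise_sum eps (fun k => W u n k - v) n t|) @ \oo --> 0].
  (* The deviations are at most [Bd], so their squares are at most [Bd] times the deviations
     themselves, whose mean vanishes by [weight_limit]. *)
  apply: (noise_sqr (y := fun=> M)
    (z := fun n => (Bd * M) * \sum_(1 <= k < n.+1) enorm (W u n k - v))) => //.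
    move=> n; rewrite mulr_sumr big_nat [leRHS]big_nat; apply: ler_sum => k kn.
    rewrite expr2 mulrAC; apply: ler_wpM2r; first exact: enorm_ge0.
    by apply: ler_wpM2r => //; apply: HBd; lia.
  by under eq_fun do rewrite mulrCA; exact: cvg0Ml.
have [m3 j3 r3] : [/\ forall n, measurable_fun setT (noise_sum xi (W u n) n),
      forall n, intble P (fun t => `|noise_sum xi (W u n) n t|)
    & (fun n => \int[P]_t `|noise_sum xi (W u n) n t|) @ \oo --> 0].
  apply: (noise_sqr (y := x) (z := fun n => B ^+ 2 * \sum_(0 <= k < n) x k.+1)) => //.
    move=> n; rewrite big_add1/= mulr_sumr big_nat [leRHS]big_nat; apply: ler_sum => k kn.
    apply: ler_wpM2r; first exact: x0.
    by rewrite ler_sqr ?nnegrE ?enorm_ge0//; apply: WB; lia.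
  under eq_fun do rewrite mulrCA; apply: cvg0Ml; apply: cesaro0.
  by move: x_cvg0; rewrite -cvg_shiftS.
pose y0 := Delta0 - gamma 1%N *: (A *m Delta0).
pose K1 := (gamma 1%N)^-1 * (B * enorm y0).
have g1 : 0 < (gamma 1%N)^-1 by rewrite invr_gt0 gamma_gt0.
have K10 : 0 <= K1 by rewrite !mulr_ge0 ?enorm_ge0// ltW.
(* [Y] gathers the bias up to index [N], without integrability; [Yn n] is the later part, where [Ee]
   applies. *)
pose Y t := \sum_(1 <= k < N.+1) enorm (e k t).
have Y0 t : 0 <= Y t by apply: sumr_ge0 => k _; exact: enorm_ge0.
pose Yn n t := \sum_(N.+1 <= k < n.+1) enorm (e k t).
have Yn0 n t : 0 <= Yn n t by apply: sumr_ge0 => k _; exact: enorm_ge0.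
have men k : measurable_fun setT (fun t => enorm (e k t)).
  by apply: measurable_enorm; exact: (adapted_mvec fF ae).
have jYn n : intble P (Yn n).
  rewrite /Yn; under eq_fun do rewrite big_nat.
  by apply: intble_sum => k /andP[/ltnW Nk _]; exact: je.
pose tl n t := Num.min 1 (q n * (B * Y t)).
have tl0 n t : 0 <= tl n t by rewrite le_min ler01 mulr_ge0// mulr_ge0.
have tl1 n t : tl n t <= 1 by rewrite ge_min lexx.
have mtl n : measurable_fun setT (tl n).
  apply: measurable_minr => //; do 2 apply: measurable_funM => //.
  exact: measurable_sum.
have jtl n : intble P (tl n).
  by apply: (intble_bounded P (B := 1)) => // t; rewrite ger0_norm.
have Etl : (fun n => \int[P]_t tl n t) @ \oo --> 0.
  have [] := @Ex_dct R d T P tl (fun=> 0) (fun=> 1) mtl _ (intble_cst P 1).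
  - exact: measurable_cst.
  - move=> t; apply: (@cvg0_le R _ (fun n => q n * (B * Y t)) 0).
      by move=> n _; rewrite ger0_norm// ge_min lexx orbT.
    by apply: cvg0Mr; exact: cvg_inv_sqrtn0.
  - by move=> n t; rewrite ger0_norm.
  by rewrite Ex_cst.
have jmin n : intble P (fun t => Num.min 1 `|remainder u n t|).
  apply: (intble_bounded P (B := 1)) => [|t].
    apply: measurable_minr => //; apply: measurableT_comp => //.
    exact: measurable_remainder.
  by rewrite ger0_norm ?ge_min ?lexx// le_min ler01 normr_ge0.
pose bd n := q n * K1 + \int[P]_t `|noise_sum eps (fun k => W u n k - v) n t|
  + \int[P]_t `|noise_sum xi (W u n) n t|
  + B * `|K| * (q n * \sum_(1 <= k < n.+1) gamma k) + \int[P]_t tl n t.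
apply: (@cvg0_le _ _ bd N.+1); last first.
  apply: cvg0D => //; apply: cvg0D; last by apply: cvg0Ml; exact: kronecker_sqrt.
  do 2 apply: cvg0D => //.
  by apply: cvg0Mr; exact: cvg_inv_sqrtn0.
move=> n Nn; have np : (0 < n)%N := leq_ltn_trans (leq0n N) Nn.
rewrite ger0_norm; last first.
  by apply: Rintegral_ge0 => t _; rewrite le_min ler01 normr_ge0.
have jc : intble P (fun=> q n * K1) := intble_cst P _.
have ja := intbleD (intbleD jc (j2 n)) (j3 n).
have jb := intbleZ (q n * B) (jYn n).
have jab := intbleD ja jb; have jall := intbleD jab (jtl n).
apply: le_trans (Ex_le (jmin n) jall _) _.
  move=> t; apply: min1_leD.
  - rewrite !addr_ge0//; first exact: mulr_ge0.
    by rewrite mulr_ge0// mulr_ge0.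
  - by rewrite mulr_ge0// mulr_ge0.
  rewrite remainder_decomp//.
  have h1 : `|q n * ((gamma 1%N)^-1 * dot (W u n 1) y0)| <= q n * K1.
    rewrite !normrM (ger0_norm (q0 n)) (gtr0_norm g1); apply: ler_wpM2l => //.
    rewrite ler_pM2l//; apply: le_trans (cauchy_schwarz _ _) _.
    by apply: ler_wpM2r; [exact: enorm_ge0|exact: WB].
  have h2 : `|noise_sum e (W u n) n t| <= q n * B * Yn n t + q n * (B * Y t).
    rewrite /noise_sum normrM (ger0_norm (q0 n)) -mulrA -mulrDr; apply: ler_wpM2l => //.
    rewrite -mulrDr addrC /Y /Yn -big_cat_nat//=; last exact: leqW.
    rewrite mulr_sumr; apply: le_trans (ler_norm_sum _ _ _) _.
    rewrite big_nat [leRHS]big_nat; apply: ler_sum => k kn.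
    apply: le_trans (cauchy_schwarz _ _) _; apply: ler_wpM2r; first exact: enorm_ge0.
    exact: WB kn.
  apply: le_trans (ler_normD _ _) _; apply: le_trans (lerD (ler_normD _ _) h2) _.
  rewrite addrA !lerD2r; apply: le_trans (ler_normD _ _) _.
  by rewrite lerD2r.
rewrite RintegralD// RintegralD// RintegralD//; last exact: intbleD.
rewrite RintegralD// Ex_cst RintegralZl// /bd lerD2r lerD2l.
rewrite [leLHS](_ : _ = q n * (B * \int[P]_t Yn n t)); last by rewrite mulrA.
rewrite [leRHS]mulrCA; apply: ler_wpM2l => //; rewrite -mulrA; apply: ler_wpM2l => //.
have -> : \int[P]_t Yn n t = \sum_(N.+1 <= k < n.+1 | (N < k < n.+1)%N)
    \int[P]_t enorm (e k t).
  rewrite -Ex_sum => [|k /andP[/ltnW Nk _]]; last exact: je.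
  by apply: eq_Rintegral => t _; rewrite /Yn big_nat.
rewrite mulr_sumr [leRHS](@big_cat_nat _ _ _ N.+1)//=; last exact: leqW.
rewrite -[leLHS]add0r; apply: lerD.
  by rewrite big_nat; apply: sumr_ge0 => k /andP[k0 _]; rewrite mulr_ge0// ltW// gamma_gt0.
rewrite [leRHS]big_nat; apply: ler_sum => k /andP[Nk _].
apply: le_trans (Ee (ltnW Nk)) _; apply: ler_wpM2r; last exact: ler_norm.
by rewrite ltW// gamma_gt0// (leq_ltn_trans (leq0n N) Nk).
Qed.

Lemma main_sqr u n : (0 < n)%N -> intble P (fun t => main_term u n t ^+ 2) /\
  \int[P]_t (main_term u n t ^+ 2) <= enorm (invmx A *m u) ^+ 2 * M.
Proof.
move=> n0; have [j h] := weighted_sum_sqr fF aeps (fun=> invmx A *m u) n ceps jeps Eeps.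
have E : (fun t => main_term u n t ^+ 2) = fun t =>
    q n ^+ 2 * (\sum_(1 <= k < n.+1) dot (invmx A *m u) (eps k t)) ^+ 2.
  by apply/funext => t; rewrite /main_term exprMn.
split; first by rewrite E; exact: intbleZ.
rewrite (_ : \int[P]_t _ = q n ^+ 2 *
  \int[P]_t ((\sum_(1 <= k < n.+1) dot (invmx A *m u) (eps k t)) ^+ 2)); last first.
  by rewrite -RintegralZl// -E.
rewrite q2 ler_pdivrMl ?ltr0n//; apply: le_trans h _.
by rewrite sumr_const_nat subSS subn0 mulr_natl.
Qed.

(** Coordinatewise, with [L >= 2]: if a coordinate exceeds [L], either its remainder is at least 1
    or its main term is at least [L / 2]. Truncated mean and Chebyshev handle the two cases. *)
Lemma scaled_mean_tight (ep : R) : 0 < ep ->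
  exists (L : R) (n0 : nat), forall n, (n0 <= n)%N -> exists psi : T -> R,
    [/\ intble P psi, forall t, 0 <= psi t,
        forall t, ~ box L (scaled_mean n t) -> 1 <= psi t & \int[P]_t psi t <= ep].
Proof.
move=> ep0; pose dl (i : 'I_p) : 'cV[R]_p := delta_mx i ord0.
have M0 : 0 <= M.
  by apply: le_trans (Eeps (k := 1) isT); apply: Rintegral_ge0 => t _; exact: sqr_ge0.
pose S := \sum_i enorm (invmx A *m dl i) ^+ 2 * M.
have S0 : 0 <= S by apply: sumr_ge0 => i _; rewrite mulr_ge0// sqr_ge0.
(* [L >= 2] gives [L^2 >= 2 L], so [ep / 2 * L^2 >= ep * L >= 8 S], more than the Chebyshev bound
   [4 S / L^2 <= ep / 2] asks for. *)
pose L := 2 + 8 * S / ep.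
have SL : 8 * S / ep * ep = 8 * S by rewrite divfK// gt_eqF.
have SL0 : 0 <= 8 * S / ep by rewrite divr_ge0 ?mulr_ge0// ltW.
have L2 : 2 <= L by rewrite /L lerDl.
have L20 : 0 < L ^+ 2 by rewrite exprn_gt0//; lra.
have hr : (fun n => \sum_i \int[P]_t Num.min 1 `|remainder (dl i) n t|) @ \oo --> 0.
  by apply: cvg0_sum => i; exact: remainder_cvg0.
have ep2 : 0 < ep / 2 by rewrite divr_gt0.
have [n0 Hn0] := eventually_le hr ep2.
exists L, n0.+1 => n n0n; have np : (0 < n)%N := leq_ltn_trans (leq0n n0) n0n.
have jm i : intble P (fun t => Num.min 1 `|remainder (dl i) n t|).
  apply: (intble_bounded P (B := 1)) => [|t].
    apply: measurable_minr => //; apply: measurableT_comp => //.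
    exact: measurable_remainder.
  by rewrite ger0_norm ?ge_min ?lexx// le_min ler01 normr_ge0.
have js i := (main_sqr (dl i) np).1.
have jt i : intble P (fun t => 4 / L ^+ 2 * main_term (dl i) n t ^+ 2
    + Num.min 1 `|remainder (dl i) n t|).
  by apply: intbleD => //; exact: intbleZ.
have t0 i t : 0 <= 4 / L ^+ 2 * main_term (dl i) n t ^+ 2
    + Num.min 1 `|remainder (dl i) n t|.
  apply: addr_ge0; last by rewrite le_min ler01 normr_ge0.
  by apply: mulr_ge0; [rewrite divr_ge0// ltW|exact: sqr_ge0].
exists (fun t => \sum_i (4 / L ^+ 2 * main_term (dl i) n t ^+ 2
    + Num.min 1 `|remainder (dl i) n t|)); split.
- exact: intble_sum.
- by move=> t; exact: sumr_ge0.
- move=> t /existsNP[i /negP]; rewrite -ltNge => hi.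
  rewrite (bigD1 i)//=; apply: le_trans (_ : 4 / L ^+ 2 * main_term (dl i) n t ^+ 2
    + Num.min 1 `|remainder (dl i) n t| <= _); last by rewrite lerDl sumr_ge0.
  have xE : scaled_mean n t i ord0 = main_term (dl i) n t + remainder (dl i) n t.
    by rewrite /remainder addrC subrK dot_delta.
  move: hi; rewrite xE => hi.
  have := lt_le_trans hi (ler_normD _ _) => {}hi.
  have [r1|r1] := leP 1 `|remainder (dl i) n t|.
    by rewrite lerDr mulr_ge0 ?sqr_ge0// divr_ge0// ltW.
  apply: le_trans (_ : 4 / L ^+ 2 * main_term (dl i) n t ^+ 2 <= _); last first.
    by rewrite lerDl.
  have h : L / 2 <= `|main_term (dl i) n t| by lra.
  rewrite mulrAC ler_pdivlMr// mul1r -(real_normK (num_real (main_term (dl i) n t))).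
  have hL : 0 <= L / 2 by lra.
  have := ler_pM hL hL h h; rewrite -!expr2 expr_div_n => h'; lra.
- rewrite Ex_sum//.
  rewrite (eq_bigr (fun i => 4 / L ^+ 2 * (\int[P]_t (main_term (dl i) n t ^+ 2)) +
    \int[P]_t Num.min 1 `|remainder (dl i) n t|)); last first.
    by move=> i _; rewrite RintegralD ?RintegralZl//; exact: intbleZ.
  rewrite big_split/= [leRHS]splitr; apply: lerD; last first.
    by have := Hn0 n (ltnW n0n); apply: le_trans; exact: ler_norm.
  apply: le_trans (_ : 4 / L ^+ 2 * S <= _).
    rewrite -mulr_sumr; apply: ler_wpM2l; first by rewrite divr_ge0// ltW.
    by apply: ler_sum => i _; exact: (main_sqr (dl i) np).2.
  rewrite mulrAC ler_pdivrMr//.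
  have h1 : ep * L = 2 * ep + 8 * S by rewrite /L mulrDr mulrC [ep * _]mulrC SL.
  have h2 : ep / 2 * (2 * L) <= ep / 2 * L ^+ 2.
    by rewrite ler_pM2l// expr2 ler_wpM2r// (le_trans _ L2).
  by lra.
Qed.

Lemma scaled_mean_cos u (th s : R) :
  (fun n => \int[P]_t cos (main_term u n t + th)) @ \oo --> s ->
  (fun n => \int[P]_t cos (dot u (scaled_mean n t) + th)) @ \oo --> s.
Proof.
move=> h; apply/subr_cvg0; move/subr_cvg0 : h => h.
rewrite (_ : (fun n => _) = fun n =>
  (\int[P]_t cos (dot u (scaled_mean n t) + th) - \int[P]_t cos (main_term u n t + th))
  + (\int[P]_t cos (main_term u n t + th) - s)); last first.
  by apply/funext => n; ring.
apply: cvg0D => //.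
apply: (@cvg0_le _ _ (fun n => 2 * \int[P]_t Num.min 1 `|remainder u n t|) 0); last first.
  by apply: cvg0Ml; exact: remainder_cvg0.
move=> n _.
have jcos (f : T -> R) : measurable_fun setT f -> intble P (fun t => cos (f t + th)).
  move=> mf; apply: (intble_bounded P (B := 1)) => [|t]; last exact: cos_max.
  apply: measurableT_comp (@measurable_cos R) _.
  by apply: measurable_funD => //; exact: measurable_cst.
have jX : intble P (fun t => cos (dot u (scaled_mean n t) + th)).
  by apply: jcos; apply: measurable_dot; exact: measurable_scaled_mean.
have jM : intble P (fun t => cos (main_term u n t + th)).
  by apply: jcos; exact: measurable_main.
have jm : intble P (fun t => Num.min 1 `|remainder u n t|).
  apply: (intble_bounded P (B := 1)) => [|t].
    apply: measurable_minr => //; apply: measurableT_comp => //.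
    exact: measurable_remainder.
  by rewrite ger0_norm ?ge_min ?lexx// le_min ler01 normr_ge0.
rewrite -RintegralB// -RintegralZl//; apply: normr_Ex_le.
- exact: intbleB.
- exact: intbleZ.
- move=> t; have := normr_cosB (main_term u n t + th) (remainder u n t).
  rewrite (_ : main_term u n t + th + remainder u n t = dot u (scaled_mean n t) + th);
    last by rewrite /remainder; ring.
  by move=> h'; apply: le_trans h' _; rewrite minr_pMr// mulr1.
Qed.

End averaged_iterates.

(** A phase carries real and imaginary part of the characteristic function at once; the sine
    integral is 0. *)
Lemma gaussian_vec_cos {R : realType} {d : measure_display} {T : measurableType d}
    {p : nat} (P : probability T R) (Y : T -> 'cV[R]_p) (S : 'M[R]_p) u (th : R) :
  gaussian_vec P Y S ->
  \int[P]_t cos (dot u (Y t) + th) = expR (- dot u (S *m u) / 2) * cos th.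
Proof.
move=> [mY /(_ u) [Ec Es]].
have mu : measurable_fun setT (fun t => dot u (Y t)) by exact: measurable_dot.
have jc : intble P (fun t => cos (dot u (Y t))).
  apply: (intble_bounded P (B := 1)) => [|t]; last exact: cos_max.
  exact: measurableT_comp (@measurable_cos R) mu.
have js : intble P (fun t => sin (dot u (Y t))).
  apply: (intble_bounded P (B := 1)) => [|t]; last exact: sin_max.
  exact: measurableT_comp (@measurable_sin R) mu.
have E1 : \int[P]_t cos (dot u (Y t)) = expR (- dot u (S *m u) / 2).
  by rewrite /Rintegral Ec/= /dot mulmxA.
have E2 : \int[P]_t sin (dot u (Y t)) = 0 by rewrite /Rintegral Es.
have j1 := intbleZ (cos th) jc; have j2 := intbleZ (sin th) js.
transitivity (\int[P]_t (cos th * cos (dot u (Y t)) - sin th * sin (dot u (Y t)))).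
  by apply: eq_Rintegral => t _; rewrite cosD; ring.
by rewrite RintegralB// !RintegralZl// E1 E2 mulr0 subr0 mulrC.
Qed.

Theorem theorem4 (R : realType) (dT : measure_display) (T : measurableType dT)
  (P : probability T R) (dim : nat) (F : nat -> set (set T))
  (A Sigma : 'M[R]_dim) (gamma : nat -> R)
  (eps xi e : nat -> T -> 'cV[R]_dim) (Delta0 : 'cV[R]_dim)
  (Delta : nat -> T -> 'cV[R]_dim) :
  filtration F ->
  (* adaptedness *)
  (forall n, Gmeasurable_vec (F n) (eps n)) ->
  (forall n, Gmeasurable_vec (F n) (xi n)) ->
  (forall n, Gmeasurable_vec (F n) (e n)) ->
  (* positive step sizes *)
  (forall n, (0 < n)%N -> 0 < gamma n) ->
  (* the recursion *)
  (forall t, Delta 0%N t = Delta0) ->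
  (forall n t, (0 < n)%N ->
     Delta n t = Delta n.-1 t - gamma n *: (A *m Delta n.-1 t)
                 + gamma n *: (eps n t + xi n t + e n t)) ->
  (* (i) *)
  sym_posdef A ->
  (* (ii) *)
  mds P F eps ->
  (exists C : R, 0 < C /\ forall n, (0 < n)%N ->
     cond_exp_le P (F n.-1) (fun t => enorm (eps n t) ^+ 4) C) ->
  sym_posdef Sigma ->
  (exists V : nat -> T -> 'M[R]_dim,
     (forall n, (0 < n)%N -> forall i j : 'I_dim,
        is_cond_exp P (F n.-1) (fun t => (eps n t *m (eps n t)^T) i j)
                               (fun t => V n t i j)) /\
     cvg_in_prob P V Sigma) ->
  (* (iii) *)
  mds P F xi ->
  (exists (N : nat) (K : R), 0 < K /\ forall n, (N <= n)%N -> (0 < n)%N ->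
     cond_exp_le P (F n.-1) (fun t => enorm (xi n t) ^+ 2) (K * gamma n)) ->
  (* (iv) E ||e_n|| = O(gamma_n) *)
  (exists (N : nat) (K : R), forall n, (N <= n)%N ->
     (\int[P]_t (enorm (e n t))%:E <= (K * gamma n)%:E)%E) ->
  (* (v) *)
  gamma @ \oo --> 0 ->
  (fun n => ((gamma n - gamma n.-1) / gamma n) / gamma n) @ \oo --> 0 ->
  cvg (series (fun j : nat => gamma j.+1 / Num.sqrt (j.+1)%:R) @ \oo) ->
  (* conclusion: sqrt n * (1/n) sum_{i=1}^n Delta_i -> N(0, A^-1 Sigma A^-1) *)
  cvg_dist_normal P
    (fun n t => (Num.sqrt n%:R) *: (n%:R^-1 *: \sum_(1 <= i < n.+1) Delta i t))
    (invmx A *m Sigma *m invmx A).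
Proof.
move=> fF aeps axi ae gamma_gt0 D0 Drec pA [ceps [M HM]] [C [C0 HC]] pS [V [cV cvgV]].
move=> [cxi [M' HM']] [N1 [K1 [K10 HK1]]] [N [K HK]] gamma0 dgamma0 gsum.
move=> d' T' P' Y gY f cf [B fB].
have [sF [FT _]] := fF.
have mnorm (X : nat -> T -> 'cV[R]_dim) : (forall n, Gmeasurable_vec (F n) (X n)) ->
    forall n, measurable_fun setT (fun t => enorm (X n t)).
  by move=> aX n; apply: measurable_enorm; exact: (adapted_mvec fF aX).
have sqr (X : nat -> T -> 'cV[R]_dim) (m : R) : (forall n, Gmeasurable_vec (F n) (X n)) ->
    (forall n, (0 < n)%N -> (\int[P]_t (enorm (X n t) ^+ 2)%:E <= m%:E)%E) ->
    forall n, (0 < n)%N -> intble P (fun t => enorm (X n t) ^+ 2) /\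
      \int[P]_t (enorm (X n t) ^+ 2) <= m.
  move=> aX H n n0; apply: intble_of_finite; last exact: H.
    by apply: measurable_funX; exact: mnorm.
  by move=> t; exact: sqr_ge0.
have eps2 := sqr eps M aeps HM; have xi2 := sqr xi M' axi HM'.
have eps4 k (k0 : (0 < k)%N) := cond_exp_le_Ex (sF k.-1) (HC k k0).
(* The exact second moment serves as its own bound at every index, while the conditional estimate,
   available from [N1] on, is needed only for its limit. *)
pose x k := \int[P]_t (enorm (xi k t) ^+ 2).
have x0 : x @ \oo --> 0.
  apply: (@cvg0_le _ _ (fun n => K1 * gamma n) (maxn N1 1)); last exact: cvg0Ml.
  move=> n; rewrite geq_max => /andP[Nn n0].
  rewrite ger0_norm; last by apply: Rintegral_ge0 => t _; exact: sqr_ge0.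
  exact: (cond_exp_le_Ex (sF n.-1) (HK1 n Nn n0)).2.
have en k : (N <= k)%N -> intble P (fun t => enorm (e k t)) /\
    \int[P]_t (enorm (e k t)) <= K * gamma k.
  move=> Nk; apply: intble_of_finite; [exact: mnorm|by move=> t; exact: enorm_ge0|].
  exact: HK.
have mX n : measurable_vec (scaled_mean Delta n).
  exact: (measurable_scaled_mean fF aeps axi ae D0 Drec).
have [mY _] := gY.
apply: (@levy_continuity R dim dT T P d' T' P' (scaled_mean Delta) Y mX mY _ _ f B) => //.
  exact: (scaled_mean_tight fF aeps axi ae gamma_gt0 D0 Drec pA ceps cxi
    (fun k k0 => (eps2 k k0).1) (fun k k0 => (eps2 k k0).2) (fun k k0 => (xi2 k k0).1)
    (fun k k0 => lexx (x k)) x0 (fun k k0 => (en k k0).1) (fun k k0 => (en k k0).2)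
    gamma0 dgamma0 gsum).
move=> u th; rewrite (gaussian_vec_cos _ _ gY).
apply: (scaled_mean_cos fF aeps axi ae gamma_gt0 D0 Drec pA ceps cxi
  (fun k k0 => (eps2 k k0).1) (fun k k0 => (eps2 k k0).2) (fun k k0 => (xi2 k k0).1)
  (fun k k0 => lexx (x k)) x0 (fun k k0 => (en k k0).1) (fun k k0 => (en k k0).2)
  gamma0 dgamma0 gsum).
pose v := invmx A *m u.
(* [invmx A] is symmetric, so one copy of it moves to the left argument and the limiting variance
   becomes the form of [Sigma] at [v]. *)
have sE : dot u (invmx A *m Sigma *m invmx A *m u) = dot v (Sigma *m v).
  by rewrite -!mulmxA (dot_mulmxr (invmx A)) trmx_inv; have [-> _] := sym_posdef_dot pA.
have s0 : 0 <= dot v (Sigma *m v).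
  have [->|v0] := eqVneq v 0; first by rewrite dot0l.
  by have [_ /(_ _ v0)/ltW] := sym_posdef_dot pS.
have [b b0 Hb] := uniform_variance fF aeps (ltW C0) (fun k k0 => (eps4 k k0).1)
  (fun k k0 => (eps4 k k0).2) cV cvgV s0.
have eta4 k (k0 : (0 < k)%N) := dot_fourth_moment fF aeps v (eps4 k k0).1 (eps4 k k0).2.
rewrite sE; apply: (martingale_clt fF s0 _ _ (fun k k0 => (eta4 k k0).1)
  (fun k k0 => (eta4 k k0).2) b0 Hb).
- by move=> k _; exact: Gmeasurable_dot.
- by move=> k k0; apply: cond_exp_dot0 => //; exact: ceps.
Qed.
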